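(* Let $W:[0,1]^2\to[0,1]$ be a Riemann integrable graphon with $\sup_{x,y\in[0,1]}W(x,y)<1$, and let $\boldsymbol{G}\sim\mathcal{G}(n,W)$. Then for any $(\mathcal{M},\boldsymbol{\alpha})\in\mathcal{C}_\lambda$, with high probability as $n\to\infty$, $$\chi(\boldsymbol{G})\le\Big(\sum_{\mu\in\mathcal{M}}\alpha_\mu\varphi(\mu,W)+o(1)\Big)\frac{n}{2\log n};$$ that is, for every fixed $\epsilon>0$, $\mathbb{P}\big(\chi(\boldsymbol{G})\le(\sum_{\mu\in\mathcal{M}}\alpha_\mu\varphi(\mu,W)+\epsilon)\frac{n}{2\log n}\big)\to1$ as $n\to\infty$.
   Context: A graphon is a symmetric measurable function $W:[0,1]^2\to[0,1]$. The random graph $\mathcal{G}(n,W)$ has vertex set $[n]=\{1,\dots,n\}$: sample $X_1,\dots,X_n$ independently and uniformly from $[0,1]$; conditionally on these, each edge $ij$ ($i\ne j$) is present independently with probability $W(X_i,X_j)$. $\chi(G)$ is the chromatic number, $\log$ is the natural logarithm, $\lambda$ is the Lebesgue (uniform) measure on $[0,1]$, and $\mathcal{P}([0,1])$ is the set of probability measures on $[0,1]$. $\mathcal{C}_\lambda$ is the set of pairs $(\mathcal{M},\boldsymbol{\alpha})$ where $\mathcal{M}\subset\mathcal{P}([0,1])$ is finite and $\boldsymbol{\alpha}=(\alpha_\mu)_{\mu\in\mathcal{M}}\in[0,1]^{|\mathcal{M}|}$ satisfies $\sum_{\mu\in\mathcal{M}}\alpha_\mu=1$ and $\sum_{\mu\in\mathcal{M}}\alpha_\mu\mu=\lambda$.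 For $\mu\in\mathcal{P}([0,1])$, $$\varphi(\mu,W):=\sup_{S\subseteq[0,1]:\ \mu(S)>0}\frac1{\mu(S)}\int_S\int_S\log\Big(\frac1{1-W(x,y)}\Big)\,d\mu(x)\,d\mu(y),$$ the supremum being over measurable $S$ with $\mu(S)>0$. *)

(* Defs.v *)
From HB Require Import structures.
From mathcomp Require Import all_boot all_order all_algebra.
From mathcomp Require Import all_classical all_reals all_analysis.

Set Implicit Arguments.
Unset Strict Implicit.
Unset Printing Implicit Defensive.
Import Order.TTheory GRing.Theory Num.Theory.
Import numFieldNormedType.Exports.
Local Open Scope classical_set_scope.
Local Open Scope ring_scope.

(* Functions on [0,1]^2 are represented by W : R -> R -> R; only the values on
   [0,1]^2 matter, and every definition below only looks at those. *)

(* "Measurable" is Borel measurable: [phi] integrates W against arbitrary Borel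
   probability measures on [0,1]. *)
Record is_graphon (R : realType) (W : R -> R -> R) : Prop := IsGraphon {
  graphon_measurable :
    measurable_fun (`[0, 1] `*` `[0, 1] : set (R * R)) (fun p => W p.1 p.2) ;
  graphon_sym : forall x y, x \in `[0, 1] -> y \in `[0, 1] -> W x y = W y x ;
  graphon_range :
    forall x y, x \in `[0, 1] -> y \in `[0, 1] -> 0 <= W x y <= 1 }.

(* The partition 0 = x_0 < x_1 < ... < x_m = 1 is represented, as in
   [itv_partition 0 1 s], by s = [:: x_1; ...; x_m]. *)
Definition part_itv (R : realType) (s : seq R) (i : nat) : set R :=
  `[(0 :: s)`_i, s`_i].

Definition part_len (R : realType) (s : seq R) (i : nat) : R :=
  s`_i - (0 :: s)`_i.

Definition lower_sum (R : realType) (W : R -> R -> R) (s t : seq R) : R :=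
  \sum_(i < size s) \sum_(j < size t)
    inf [set W x y | x in part_itv s i & y in part_itv t j]
      * (part_len s i * part_len t j).

Definition upper_sum (R : realType) (W : R -> R -> R) (s t : seq R) : R :=
  \sum_(i < size s) \sum_(j < size t)
    sup [set W x y | x in part_itv s i & y in part_itv t j]
      * (part_len s i * part_len t j).

Definition lower_integral (R : realType) (W : R -> R -> R) : R :=
  sup [set lower_sum W s t | s in itv_partition 0 1 & t in itv_partition 0 1].

Definition upper_integral (R : realType) (W : R -> R -> R) : R :=
  inf [set upper_sum W s t | s in itv_partition 0 1 & t in itv_partition 0 1].

Definition riemann_integrable (R : realType) (W : R -> R -> R) : Prop :=
  (exists M, forall x y, x \in `[0, 1] -> y \in `[0, 1] -> `|W x y| <= M) /\
  lower_integral W = upper_integral W.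

(* [lne] and the inverse are those of \bar R, so that the kernel
   log (1 / (1 - W x y)) is +oo where W x y = 1. *)
Definition phi (R : realType) (mu : probability R R) (W : R -> R -> R)
    : \bar R :=
  ereal_sup [set ((mu S)^-1 * \int[mu]_(y in S) \int[mu]_(x in S)
                     lne (1 / (1 - W x y)%:E))%E
            | S in [set S : set R | [/\ measurable S, S `<=` `[0, 1] & (0 < mu S)%E]]].

(* The pairs (M, alpha) in C_lambda; a probability measure on [0,1] is a
   probability measure on R giving mass 1 to [0,1]. *)
Record in_C_lambda (R : realType) (M : set (probability R R))
    (alpha : probability R R -> R) : Prop := InCLambda {
  CL_finite : finite_set M ;
  CL_supp : forall mu, M mu -> mu `[0, 1]%classic = 1%E ;
  CL_range : forall mu, M mu -> 0 <= alpha mu <= 1 ;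
  CL_sum : \sum_(mu \in M) alpha mu = 1 ;
  CL_mean : forall A : set R, measurable A ->
    (\sum_(mu \in M) (alpha mu)%:E * mu A)%E = uniform_prob (@ltr01 R) A }.

Record sgraph (V : finType) := SGraph {
  adj : rel V ;
  adj_sym : symmetric adj ;
  adj_irr : irreflexive adj }.

Definition colorable (V : finType) (G : sgraph V) (k : nat) : bool :=
  [exists c : {ffun V -> 'I_k},
     [forall u, forall v, adj G u v ==> (c u != c v)]].

Lemma colorable_ex (V : finType) (G : sgraph V) : exists k, colorable G k.
Proof.
exists #|V|; apply/existsP; exists [ffun v => enum_rank v].
apply/forallP => u; apply/forallP => v; apply/implyP => uv.
rewrite !ffunE; apply: contraTneq uv => /enum_rank_inj ->.
by rewrite adj_irr.
Qed.

Definition chi (V : finType) (G : sgraph V) : nat := ex_minn (colorable_ex G).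

(* p is a version of the conditional probability P(E | F), where F is a
   sub-sigma-algebra. *)
Definition is_cond_prob (R : realType) (d : measure_display)
    (T : measurableType d) (P : probability T R) (F : set (set T)) (E : set T)
    (p : T -> R) : Prop :=
  (forall B : set R, measurable B -> F (p @^-1` B)) /\
  (forall A, F A -> P (A `&` E) = (\int[P]_(w in A) (p w)%:E)%E).

(* G is sampled from G(n,W) on the probability space (T, P), the vertices being
   0, ..., n-1: for some X_0, ..., X_(n-1) that are independent and uniform on
   [0,1], the conditional law of G given (X_i)_i makes the edges ij, i < j,
   independent Bernoulli(W(X_i,X_j)). *)
Definition is_Gnw (R : realType) (W : R -> R -> R) (n : nat)
    (d : measure_display) (T : measurableType d) (P : probability T R)
    (G : T -> sgraph 'I_n) : Prop :=
  (forall i j, measurable [set w | adj (G w) i j]) /\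
  exists X : 'I_n -> {RV P >-> R},
  [/\ forall i w, X i w \in `[0, 1],
      forall i (A : set R), measurable A ->
        distribution P (X i) A = uniform_prob (@ltr01 R) A,
      forall B : 'I_n -> set R, (forall i, measurable (B i)) ->
        P (\bigcap_(i in [set: 'I_n]) (X i @^-1` B i)) =
        (\prod_(i < n) P (X i @^-1` B i))%E
    & forall H : sgraph 'I_n,
        is_cond_prob P (g_sigma_preimage (fun i => X i : T -> R))
          [set w | adj (G w) =2 adj H]
          (fun w => \prod_(i < n) \prod_(j < n | (i < j)%N)
             (if adj H i j then W (X i w) (X j w)
              else 1 - W (X i w) (X j w)))].

(* Main.v *)
(** A Riemann integrable kernel is squeezed between two step functions over
    finitely many vertex types whose integrals are close, so W may be replaced
    by the upper one, with edge probabilities 1 - exp(-k(a,b)), at a small cost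
    in phi.  For a measure mu, put L = 2 log n / phi: an edgeless set with about
    mu(a) L vertices of each type a has expected number at least n^(c L), and
    the definition of phi, applied to unions of types, says that no sub-profile
    is an obstruction.  By a second moment computation the largest number of
    such edgeless sets that pairwise share at most one vertex, inside any vertex
    set having at least about n^(1-c/2) vertices of every type used, has
    expectation at least n^(7/4).  It changes by at most 1 when one edge changes, so by the bounded
    differences inequality it vanishes with probability at most
    exp(-n^(3/2)/4), which beats a union bound over all vertex sets.  Hence one
    can colour greedily: for each mu in M, remove about alpha(mu) n / L
    independent sets with profile mu.  As the alpha-average of M is the uniform
    measure, every type is used up, except for o(n / log n) vertices. *)
Require Import Defs.
From HB Require Import structures.
From mathcomp Require Import all_boot all_order all_algebra.
From mathcomp Require Import all_classical all_reals all_analysis.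
From mathcomp Require Import measurable_realfun.
From mathcomp Require Import ring lra zify.
Import Order.TTheory GRing.Theory Num.Theory.
Import numFieldNormedType.Exports.
Set Implicit Arguments.
Unset Strict Implicit.
Unset Printing Implicit Defensive.
Local Open Scope ring_scope.

(** * Product Bernoulli measures *)

(** The cost in phi of a step kernel is measured by mu, while Riemann sums see only the uniform
    measure lambda. The link is alpha(mu) mu <= lambda, which bounds the density of mu by 1 /
    alpha(mu); sets S too light for the division by mu(S) obey the trivial bound K mu(S), with K = -
    log (1 - sup W). Bounded differences cannot be applied to the number of edgeless sets itself,
    since one edge may destroy a large share of them; among sets that pairwise share at most one
    vertex, at most one contains a given pair. The exponent 7/4 has room on both sides. Transversals
    that agree in just two slots limit the second moment method to about n^(2 - c) >= n^(15/8), and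
    an expectation n^b gives failure probability exp(- n^(2b - 2) / 4), which beats the exp(O(n log
    n)) labellings as soon as b > 3/2. The uncoloured vertices depend on the graph, so no fresh
    randomness is left at later steps: a single event, uniform over all labellings of vertices by
    slots, is shown to be likely, and the colouring is deterministic on it. *)

Section Bernoulli.
Variables (R : realType) (I : finType).
Implicit Types (p q : I -> R) (f g : {ffun I -> bool} -> R) (w : {ffun I -> bool}).

Definition wt p w : R := \prod_e (if w e then p e else 1 - p e).

Definition Ex p f : R := \sum_w wt p w * f w.

Definition upd w e b : {ffun I -> bool} := [ffun x => if x == e then b else w x].

(** Conditional expectation given all coordinates other than [e]; iterated as in [avgs], it plays
    the part of the Doob martingale of [f]. *)
Definition avg p e f w : R :=
  p e * f (upd w e true) + (1 - p e) * f (upd w e false).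

Definition avgs p (s : seq I) f := foldr (avg p) f s.

Definition is_proba p := forall e, 0 <= p e <= 1.

Lemma upd_upd w e b b' : upd (upd w e b) e b' = upd w e b'.
Proof. by apply/ffunP => x; rewrite !ffunE; case: eqP. Qed.

Lemma updC w e e' b b' : e != e' ->
  upd (upd w e b) e' b' = upd (upd w e' b') e b.
Proof.
move=> ee'; apply/ffunP => x; rewrite !ffunE.
by case: (eqVneq x e) => [->|//]; rewrite (negbTE ee').
Qed.

Lemma upd_id w e : upd w e (w e) = w.
Proof. by apply/ffunP => x; rewrite !ffunE; case: eqP => [->|]. Qed.

Lemma wt_ge0 p w : is_proba p -> 0 <= wt p w.
Proof.
move=> hp; apply: prodr_ge0 => e _.
by case/andP: (hp e) => p0 p1; case: ifP => _ //; rewrite subr_ge0.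
Qed.

Lemma sum_prod_bool (F : I -> bool -> R) :
  \sum_(w : {ffun I -> bool}) \prod_e F e (w e) = \prod_e (F e true + F e false).
Proof.
transitivity (\prod_e \sum_(b : bool) F e b); last first.
  by apply: eq_bigr => e _; rewrite big_bool.
by rewrite bigA_distr_bigA.
Qed.

Lemma Ex_cst p c : Ex p (fun=> c) = c.
Proof.
rewrite /Ex -big_distrl /= /wt.
rewrite (sum_prod_bool (fun e b => if b then p e else 1 - p e)).
by rewrite big1 ?mul1r // => e _; rewrite addrC subrK.
Qed.

Lemma Ex_none p (Q : {set I}) :
  Ex p (fun w => ([forall e in Q, ~~ w e] : bool)%:R) = \prod_(e in Q) (1 - p e).
Proof.
pose F e (b : bool) : R := (if b then p e else 1 - p e) * ((e \in Q) ==> ~~ b)%:R.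
rewrite /Ex (eq_bigr (fun w : {ffun I -> bool} => \prod_e F e (w e))); last first.
  move=> w _; rewrite /F big_split /=; congr (_ * _).
  case: (boolP [forall e in Q, ~~ w e]) => [/forall_inP h|].
    by rewrite big1 // => e _; case: (boolP (e \in Q)) => //= /h ->.
  rewrite negb_forall => /existsP [e]; rewrite negb_imply negbK => /andP[eQ we].
  by rewrite (bigD1 e) //= eQ we /= mul0r.
rewrite sum_prod_bool /F [RHS]big_mkcond /=; apply: eq_bigr => e _ /=.
by case: ifP => _ /=; rewrite ?implybT ?implybF /=; ring.
Qed.

Lemma ler_Ex p f g : is_proba p -> (forall w, f w <= g w) -> Ex p f <= Ex p g.
Proof.
by move=> hp fg; apply: ler_sum => w _; rewrite ler_wpM2l // wt_ge0.
Qed.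

Lemma eq_Ex p f g : f =1 g -> Ex p f = Ex p g.
Proof. by move=> fg; apply: eq_bigr => w _; rewrite fg. Qed.

Lemma Ex_avg p e f : Ex p (avg p e f) = Ex p f.
Proof.
pose v w := \prod_(x | x != e) (if w x then p x else 1 - p x).
have wtE w : wt p w = (if w e then p e else 1 - p e) * v w.
  by rewrite /wt (bigD1 e).
have vU w b : v (upd w e b) = v w.
  by apply: eq_bigr => x /negbTE xe; rewrite ffunE xe.
(* Moves the half with [w e] false onto the half with [w e] true, so that both can be summed over
   the same index set. *)
have flipS (h : {ffun I -> bool} -> R) :
  \sum_(w : {ffun I -> bool} | ~~ w e) h w =
  \sum_(w : {ffun I -> bool} | w e) h (upd w e false).
  rewrite (reindex_onto (fun w => upd w e false) (fun w => upd w e true)) /=.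
    apply: eq_bigl => w; rewrite !ffunE eqxx /= upd_upd.
    apply/eqP/idP => [<-|we]; first by rewrite !ffunE eqxx.
    by rewrite -[RHS](upd_id _ e) we.
  move=> w /negbTE we; rewrite upd_upd -{2}[w](upd_id _ e) we //.
pose Pe (w : {ffun I -> bool}) := w e.
rewrite /Ex (bigID Pe) [RHS](bigID Pe) /Pe /= !flipS.
rewrite -!big_split /=; apply: eq_bigr => w we.
have w1 : upd w e true = w by rewrite -[RHS](upd_id w e) we.
rewrite !wtE vU /avg !upd_upd w1 ffunE eqxx we.
by ring.
Qed.

Lemma avg_upd p e f w b : avg p e f (upd w e b) = avg p e f w.
Proof. by rewrite /avg !upd_upd. Qed.

Lemma ler_avg p e f g w : is_proba p -> (forall w, f w <= g w) ->
  avg p e f w <= avg p e g w.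
Proof.
move=> hp fg; case/andP: (hp e) => p0 p1.
by apply: lerD; rewrite ler_wpM2l // subr_ge0.
Qed.

Lemma avgZ p e c f w : avg p e (fun w => c * f w) w = c * avg p e f w.
Proof. by rewrite /avg; ring. Qed.

Lemma avgs_upd p s f w e b : e \in s -> avgs p s f (upd w e b) = avgs p s f w.
Proof.
elim: s w => //= x s IH w; rewrite inE.
have [->|ex] /= := eqVneq e x; first by rewrite avg_upd.
by move=> es; rewrite /avg !(updC _ _ _ ex) !IH.
Qed.

Lemma Ex_avgs p s f : Ex p (avgs p s f) = Ex p f.
Proof. by elim: s => //= e s IH; rewrite Ex_avg. Qed.

(** Once every coordinate is averaged out the function is constant, hence equal to its own
    expectation. Statements about [Ex] thereby become inductions on the list of coordinates. *)
Lemma Ex_avgs_enum p f w : avgs p (enum I) f w = Ex p f.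
Proof.
rewrite -(Ex_avgs p (enum I)); set g := avgs _ _ _.
have gU w' e b : g (upd w' e b) = g w' by rewrite /g avgs_upd // mem_enum.
have gC w' : g w' = g w.
  (* [h] turns [w] into [w'] by one update per coordinate, and [g] is invariant under each of
     them. *)
  pose h (s : seq I) := foldr (fun e acc => upd acc e (w' e)) w s.
  have hE s x : h s x = if x \in s then w' x else w x.
    elim: s => //= e s IH; rewrite !ffunE inE -/(h s) IH.
    by case: eqP => [->|].
  have -> : w' = h (enum I) by apply/ffunP => x; rewrite hE mem_enum.
  by elim: (enum I) => //= e s IH; rewrite gU.
by rewrite -[LHS](Ex_cst p); apply: eq_Ex => w'; rewrite gC.
Qed.

Definition lips1 f := forall w e b b', f (upd w e b) <= f (upd w e b') + 1.

Lemma lips1_avg p e f : is_proba p -> lips1 f -> lips1 (avg p e f).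
Proof.
move=> hp lf w e' b b'; have [->|ee'] := eqVneq e' e.
  by rewrite !avg_upd lerDl.
case/andP: (hp e) => p0 p1; rewrite /avg !(updC _ _ _ ee').
have h1 := lf (upd w e true) e' b b'; have h2 := lf (upd w e false) e' b b'.
by nra.
Qed.

Lemma lips1_avgs p s f : is_proba p -> lips1 f -> lips1 (avgs p s f).
Proof. by move=> hp lf; elim: s => //= e s IH; apply: lips1_avg. Qed.

(** The tangent bound gives exp(x) <= 1 / (1 - x), which is too weak for x > 0; used at x / 4 and
    raised to the fourth power it suffices on this range. *)
Lemma expR_le1Dxx2 (x : R) : `|x| <= 2^-1 -> expR x <= 1 + x + x ^+ 2.
Proof.
rewrite ler_norml => /andP[x1 x2].
pose y := x / 4; have xy : x = 4 * y by rewrite /y; field.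
have y1 : - (1 / 8) <= y by rewrite /y; lra.
have y2 : y <= 1 / 8 by rewrite /y; lra.
have -> : expR x = (expR (- y) ^+ 4)^-1.
  by rewrite -expRM_natl -expRN; congr expR; rewrite xy; ring.
have h : (1 - y) ^+ 4 <= expR (- y) ^+ 4.
  rewrite lerXn2r ?nnegrE ?expR_ge0 //; first by lra.
  exact: (expR_ge1Dx (- y)).
have p4 : 0 < (1 - y) ^+ 4 by rewrite exprn_gt0 //; lra.
apply: (@le_trans _ _ ((1 - y) ^+ 4)^-1).
  by rewrite lef_pV2 // posrE exprn_gt0 // expR_gt0.
rewrite -div1r ler_pdivrMr // xy -subr_ge0.
have -> : (1 + 4 * y + (4 * y) ^+ 2) * (1 - y) ^+ 4 - 1 =
  y ^+ 2 * ((6 - 44 * y) + y ^+ 2 * (81 - 60 * y + 16 * y ^+ 2)) by ring.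
apply: mulr_ge0; first exact: sqr_ge0.
apply: addr_ge0; first by lra.
by apply: mulr_ge0; [exact: sqr_ge0|have := sqr_ge0 y; lra].
Qed.

(** Centred at their mean [m], the two values of [f] become [(1 - P) D] and [- P D] with [|D| <= 1];
    in the quadratic bound on exp the first-order terms cancel. *)
Lemma avg_expR p e f (t : R) w : is_proba p -> lips1 f -> 0 <= t <= 2^-1 ->
  avg p e (fun w => expR (- t * f w)) w <= expR (t ^+ 2 - t * avg p e f w).
Proof.
move=> hp lf /andP[t0 t1]; rewrite /avg.
case/andP: (hp e) => p0 p1.
have := lf w e false true; have := lf w e true false.
set a := f _; set b := f _ => ab ba; set P := p e in p0 p1 *.
set m := P * a + (1 - P) * b.
have ea : expR (- t * a) = expR (- t * m) * expR (- t * (a - m)).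
  by rewrite -expRD; congr expR; ring.
have eb : expR (- t * b) = expR (- t * m) * expR (- t * (b - m)).
  by rewrite -expRD; congr expR; ring.
have -> : t ^+ 2 - t * (P * a + (1 - P) * b) = - t * m + t ^+ 2 by rewrite /m; ring.
rewrite ea eb (expRD (- t * m)) !(mulrCA _ (expR (- t * m))) -mulrDr.
rewrite ler_wpM2l ?expR_ge0 //.
have am : a - m = (1 - P) * (a - b) by rewrite /m; ring.
have bm : b - m = - P * (a - b) by rewrite /m; ring.
rewrite am bm; set D := a - b.
have D1 : D <= 1 by rewrite /D; lra.
have D2 : -1 <= D by rewrite /D; lra.
have D3 : D ^+ 2 <= 1 by nra.
have tD1 : t * D <= 2^-1 by nra.
have tD2 : - 2^-1 <= t * D by nra.
have h1 : expR (- t * ((1 - P) * D)) <= 1 - t * D * (1 - P) + (t * D) ^+ 2 * (1 - P) ^+ 2.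
  have -> : 1 - t * D * (1 - P) + (t * D) ^+ 2 * (1 - P) ^+ 2 =
    1 + (- t * ((1 - P) * D)) + (- t * ((1 - P) * D)) ^+ 2 by ring.
  by apply: expR_le1Dxx2; rewrite ler_norml; apply/andP; split; nra.
have h2 : expR (- t * (- P * D)) <= 1 + t * D * P + (t * D) ^+ 2 * P ^+ 2.
  have -> : 1 + t * D * P + (t * D) ^+ 2 * P ^+ 2 =
    1 + (- t * (- P * D)) + (- t * (- P * D)) ^+ 2 by ring.
  by apply: expR_le1Dxx2; rewrite ler_norml; apply/andP; split; nra.
have tD : (t * D) ^+ 2 <= t ^+ 2.
  by rewrite exprMn ler_piMr // sqr_ge0.
have h3 : P * expR (- t * ((1 - P) * D)) + (1 - P) * expR (- t * (- P * D)) <=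
  1 + (t * D) ^+ 2 * (P * (1 - P)).
  have e1 := ler_wpM2l p0 h1.
  have p1' : 0 <= 1 - P by rewrite subr_ge0.
  have e2 := ler_wpM2l p1' h2.
  apply: (le_trans (lerD e1 e2)); rewrite le_eqVlt; apply/orP; left.
  by apply/eqP; ring.
apply: (le_trans h3); apply: le_trans (expR_ge1Dx _).
have : 0 <= P * (1 - P) <= 1 by apply/andP; split; nra.
by move=> /andP[u1 u2]; have := sqr_ge0 (t * D); nra.
Qed.

(* Averaging out one coordinate of a 1-Lipschitz function costs a factor
   exp(t^2) in the exponential moment. *)
Lemma mcdiarmid p f (t : R) : is_proba p -> lips1 f -> 0 <= t <= 2^-1 ->
  Ex p (fun w => expR (- t * f w)) <= expR (t ^+ 2 * #|I|%:R - t * Ex p f).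
Proof.
move=> hp lf t01; have w : {ffun I -> bool} := [ffun=> false].
rewrite -!(Ex_avgs_enum _ _ w) cardE.
elim: (enum I) w => [|e s IH] w /=; first by rewrite mulr0 sub0r mulNr.
apply: (@le_trans _ _
  (expR (t ^+ 2 * (size s)%:R) * avg p e (fun w => expR (- t * avgs p s f w)) w)).
  rewrite -avgZ; apply: ler_avg => // w'; apply: (le_trans (IH _)).
  by rewrite -expRD mulNr.
apply: (@le_trans _ _
  (expR (t ^+ 2 * (size s)%:R) * expR (t ^+ 2 - t * avg p e (avgs p s f) w))).
  by rewrite ler_wpM2l ?expR_ge0 // avg_expR //; apply: lips1_avgs.
rewrite -expRD ler_expR le_eqVlt; apply/orP; left; apply/eqP.
by rewrite -natr1; ring.
Qed.

Definition antitone f := forall w e, f (upd w e true) <= f (upd w e false).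

Lemma antitone_avg p e f : is_proba p -> antitone f -> antitone (avg p e f).
Proof.
move=> hp af w e'; have [->|ee'] := eqVneq e' e.
  by rewrite !avg_upd.
case/andP: (hp e) => p0 p1; rewrite /avg !(updC _ _ _ ee').
by apply: lerD; rewrite ler_wpM2l // subr_ge0.
Qed.

(** Raising one probability at a time replaces a monotone coupling. It lets bounds for the step
    kernel serve for the smaller edge probabilities of W. *)
Lemma Ex_antitone p q f : is_proba p -> is_proba q -> (forall e, p e <= q e) ->
  antitone f -> Ex q f <= Ex p f.
Proof.
move=> hp hq pq af; have w : {ffun I -> bool} := [ffun=> false].
rewrite -!(Ex_avgs_enum _ _ w).
elim: (enum I) w => [//|e s IH] w /=.
apply: le_trans (ler_avg e w hp IH).
have : antitone (avgs q s f).
  by elim: s {IH} => //= x s IHs; apply: antitone_avg.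
move=> /(_ w e); rewrite /avg; set a := avgs _ _ _ _; set b := avgs _ _ _ _.
by have := pq e; nra.
Qed.

Lemma Ex_sum p (K : Type) (r : seq K) (P : pred K) (F : K -> {ffun I -> bool} -> R) :
  Ex p (fun w => \sum_(x <- r | P x) F x w) = \sum_(x <- r | P x) Ex p (F x).
Proof.
rewrite /Ex exchange_big /=; apply: eq_bigr => w _.
by rewrite mulr_sumr.
Qed.

Lemma ExZ p c f : Ex p (fun w => c * f w) = c * Ex p f.
Proof. by rewrite /Ex mulr_sumr; apply: eq_bigr => w _; ring. Qed.

Lemma ExB p f g : Ex p (fun w => f w - g w) = Ex p f - Ex p g.
Proof. by rewrite /Ex -sumrB; apply: eq_bigr => w _; ring. Qed.

Lemma Ex_tail p f (t z : R) : is_proba p -> lips1 f -> 0 <= t <= 2^-1 ->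
  z <= Ex p f ->
  Ex p (fun w => ((f w <= 0)%R)%:R) <= expR (t ^+ 2 * #|I|%:R - t * z).
Proof.
move=> hp lf /andP[t0 t1] zE.
have h : Ex p (fun w => ((f w <= 0)%R)%:R) <= Ex p (fun w => expR (- t * f w)).
  apply: ler_Ex => // w; case: (lerP (f w) 0) => [f0|_]; last exact: expR_ge0.
  by rewrite -[leLHS]expR0 ler_expR; nra.
apply: (le_trans h); apply: (le_trans (mcdiarmid hp lf _)); first by rewrite t0.
by rewrite ler_expR lerB // ler_wpM2l.
Qed.

End Bernoulli.

(** * Independent transversals *)

(* [all_classical] shadows many [finset] names; here and below, importing
   [finset] inside a section restores them until the end of that section. *)
Section FiniteSets.
Import mathcomp.boot.fintype mathcomp.boot.finset.

(* Turan bound |A|^2 / #(conflicts), linearised in c so that one can take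
   expectations; the pairs (x, x) count as conflicts. *)
Lemma turan (R : realType) (X : finType) (cf : rel X) (c : R) (A : {set X}) :
  reflexive cf -> symmetric cf ->
  exists S : {set X}, [/\ S \subset A,
    {in S &, forall x y, cf x y -> x = y} &
    2 * c * #|A|%:R - c ^+ 2 * \sum_(x in A) \sum_(y in A) (cf x y)%:R <=
      #|S|%:R].
Proof.
move=> cfr cfs; have [N] := ubnP #|A|; elim: N A => // N IH A AN.
have [->|[x0 x0A]] := set_0Vmem A.
  exists set0; split; rewrite ?sub0set //; first by move=> x y; rewrite inE.
  by rewrite !cards0 big_set0 !mulr0 subr0.
(* Greedy choice: keep an element of least conflict degree, discard all that conflicts with it, and
   recurse. *)
pose deg x := #|[set y in A | cf x y]|.
have [x xA0 xmin] := arg_minnP deg x0A; have {xA0} xA : x \in A := xA0.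
pose N1 := [set y in A | cf x y]; pose B := A :\: N1.
have xN : x \in N1 by rewrite inE xA cfr.
have N1A : N1 \subset A by apply/subsetP => y; rewrite inE => /andP[].
have cAB : #|A| = (#|N1| + #|B|)%N by rewrite -(cardsID N1 A) (setIidPr N1A).
have N0 : (0 < #|N1|)%N by apply/card_gt0P; exists x.
have [|S [SB Sind Sc]] := IH B; first by lia.
have xS y : y \in S -> ~~ cf x y.
  move=> /(subsetP SB); rewrite !inE => /andP[h yA]; apply: contra h => ->.
  by rewrite yA.
exists (x |: S); split.
- by rewrite subUset sub1set xA (subset_trans SB) // subsetDl.
- move=> y z; rewrite !inE => /orP[/eqP->|yS] /orP[/eqP->|zS] //.
  + by rewrite (negbTE (xS _ zS)).
  + by rewrite cfs (negbTE (xS _ yS)).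
  + exact: Sind.
have xnS : x \notin S by apply/negP => /xS; rewrite cfr.
(* By minimality each element of [N1] has degree at least [#|N1|], so at least [#|N1| ^ 2] conflicts
   disappear with [N1]. *)
have h : (\sum_(x in B) \sum_(y in B) (cf x y)%:R : R) + #|N1|%:R ^+ 2 <=
         \sum_(x in A) \sum_(y in A) (cf x y)%:R.
  rewrite [leRHS](big_setID N1) /= (setIidPr N1A) -/B [leLHS]addrC; apply: lerD.
    rewrite expr2 mulr_natl -sumr_const.
    apply: ler_sum => y yN; rewrite -natr_sum ler_nat.
    have yA : y \in A by apply: (subsetP N1A).
    apply: (leq_trans (xmin y yA)); rewrite /deg -sum1_card.
    rewrite big_mkcond [leqRHS]big_mkcond /=; apply: leq_sum => z _.
    by rewrite inE; case: (z \in A) => //=; case: (cf y z).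
  apply: ler_sum => y yB; rewrite [leRHS](big_setID N1) /= -/B lerDr.
  by apply: sumr_ge0.
rewrite cardsU1 xnS cAB !natrD /=.
have c2 := ler_wpM2l (sqr_ge0 c) h.
(* Hence [2 c #|N1| - c^2 #|N1|^2 <= 1]: what the bound loses is made up by the new element [x]. *)
have := sqr_ge0 (1 - c * #|N1|%:R); move: Sc c2.
set a := \sum_(x in B) _; set b := \sum_(x in A) _.
set u := #|N1|%:R; set v := #|B|%:R; set s := #|S|%:R.
move: a b u v s => a b u v s; nra.
Qed.

Section Transversals.
Variables (R : realType) (n : nat) (T J : finType).
Variables (th : 'I_n -> T) (sg : J -> T) (lab : 'I_n -> option J).
Variable k : T -> T -> R.
Local Notation V := 'I_n.
Implicit Types (B : {set V}) (f g : {ffun J -> V}) (w : {ffun V * V -> bool}).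

Definition pairs B : {set V * V} :=
  [set e : V * V | [&& (e.1 < e.2)%N, e.1 \in B & e.2 \in B]].

Definition indep w B := [forall e in pairs B, ~~ w e].

Lemma indepP w B :
  reflect (forall e, e \in pairs B -> ~~ w e) (indep w B).
Proof. exact: forall_inP. Qed.

Lemma pairsI B C : pairs B :&: pairs C = pairs (B :&: C).
Proof.
by apply/setP => e; rewrite !inE; case: (e.1 < e.2)%N => //=; 
  case: (e.1 \in B); rewrite //= ?andbF //; case: (e.1 \in C); rewrite ?andbF.
Qed.

Lemma sum_pairs (F : V -> V -> R) B : (forall u v, F u v = F v u) ->
  \sum_(e in pairs B) F e.1 e.2 =
  (\sum_(u in B) \sum_(v in B | v != u) F u v) / 2.
Proof.
move=> Fs; set X := LHS.
have XE : X = \sum_(u in B) \sum_(v in B | (u < v)%N) F u v.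
  rewrite pair_big_dep /X; apply: eq_bigl => -[u v] /=; rewrite inE /=.
  by case: (u \in B) => //=; rewrite ?andbF // andbC.
have XE' : X = \sum_(u in B) \sum_(v in B | (v < u)%N) F u v.
  rewrite XE (exchange_big_dep (mem B)) /=; last by move=> u v _ /andP[].
  apply: eq_bigr => u uB; apply: eq_big => v; first by rewrite uB.
  by rewrite Fs.
have -> : \sum_(u in B) \sum_(v in B | v != u) F u v = X + X.
  rewrite {1}XE XE' -big_split /=; apply: eq_bigr => u uB.
  rewrite (bigID (fun v : V => (u < v)%N)) /=; congr (_ + _); apply: eq_bigl => v.
    rewrite -andbA; congr andb; apply: andb_idl => uv.
    by apply: contraTneq uv => ->; rewrite ltnn.
  by rewrite -andbA -leqNgt ltn_neqAle.
by field.
Qed.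

(* [lab] splits a set of vertices into parts indexed by the slots J; slot j only
   receives vertices of type [sg j], and a transversal picks one vertex in each
   part. *)
Definition trans : {set {ffun J -> V}} := [set f : {ffun J -> V} | [forall j, lab (f j) == Some j]].

Definition agree f g : {set J} := [set j | f j == g j].

(** For transversals, agreeing in two slots means sharing two vertices, that is, a potential
    edge. *)
Definition conflict f g := (1 < #|agree f g|)%N.

Definition img f (I : {set J}) : {set V} := [set f j | j in I].

Lemma transP f j : f \in trans -> lab (f j) = Some j.
Proof. by rewrite inE => /forallP/(_ j)/eqP. Qed.

Lemma trans_inj f : f \in trans -> injective f.
Proof.
by move=> ft i j fij; apply: Some_inj; rewrite -(transP i ft) -(transP j ft) fij.
Qed.

Lemma imgI f g : f \in trans -> g \in trans ->
  img f [set: J] :&: img g [set: J] = img f (agree f g).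
Proof.
move=> ft gt; apply/setP => v; rewrite inE; apply/andP/imsetP.
  move=> [/imsetP[i _ ->] /imsetP[j _ ij]]; exists i => //.
  have : Some i = Some j by rewrite -(transP i ft) -(transP j gt) ij.
  by move=> -[eij]; rewrite inE ij eij.
move=> [i]; rewrite inE => /eqP fg ->; split; first by apply/imsetP; exists i.
by apply/imsetP; exists i.
Qed.

(** Minus the logarithm of the probability, under [bprob], that the vertices picked in the slots [I]
    span no edge. *)
Definition kap (I : {set J}) : R :=
  (\sum_(i in I) \sum_(j in I | j != i) k (sg i) (sg j)) / 2.

(* Edges are coded by pairs with e.1 < e.2; the other coordinates are dummies. *)
Definition bprob (e : V * V) : R :=
  if (e.1 < e.2)%N then 1 - expR (- k (th e.1) (th e.2)) else 0.

Hypothesis ksym : forall a b, k a b = k b a.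
Hypothesis kge0 : forall a b, 0 <= k a b.
Hypothesis th_lab : forall v j, lab v = Some j -> th v = sg j.

Lemma bprob_proba : is_proba bprob.
Proof.
move=> e; rewrite /bprob; case: ifP => _; last by rewrite lexx ler01.
by rewrite subr_ge0 expR_le1 oppr_le0 kge0 /= gerBl expR_ge0.
Qed.

Lemma sum_pairs_img f (I : {set J}) : f \in trans ->
  \sum_(e in pairs (img f I)) k (th e.1) (th e.2) = kap I.
Proof.
move=> ft; rewrite (@sum_pairs (fun u v => k (th u) (th v))) // /kap.
have fi := trans_inj ft; congr (_ / _).
rewrite big_imset /=; last by move=> i j _ _; exact: fi.
apply: eq_bigr => i iI; rewrite big_mkcondr /= big_imset /=; last first.
  by move=> x y _ _; exact: fi.
rewrite [RHS]big_mkcondr; apply: eq_bigr => j jI.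
rewrite (inj_eq fi) (th_lab (transP i ft)).
by rewrite (th_lab (transP j ft)).
Qed.

Lemma Ex_indep_pairs (Q : {set V * V}) : (forall e, e \in Q -> (e.1 < e.2)%N) ->
  Ex bprob (fun w => ([forall e in Q, ~~ w e] : bool)%:R) =
  expR (- \sum_(e in Q) k (th e.1) (th e.2)).
Proof.
move=> hQ; rewrite Ex_none -sumrN expR_sum; apply: eq_bigr => e /hQ he.
by rewrite /bprob he; ring.
Qed.

Lemma Ex_indep f : f \in trans ->
  Ex bprob (fun w => (indep w (img f [set: J]))%:R) = expR (- kap [set: J]).
Proof.
move=> ft; rewrite /indep Ex_indep_pairs ?sum_pairs_img //.
by move=> e; rewrite inE => /andP[].
Qed.

(** All pairs of the union must be absent. By inclusion-exclusion the common pairs count once, and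
    they lie over the slots where [f] and [g] agree. *)
Lemma Ex_indep2 f g : f \in trans -> g \in trans ->
  Ex bprob (fun w => (indep w (img f [set: J]))%:R * (indep w (img g [set: J]))%:R)
  = expR (- kap [set: J]) ^+ 2 * expR (kap (agree f g)).
Proof.
move=> ft gt; pose A := pairs (img f [set: J]); pose B := pairs (img g [set: J]).
transitivity (Ex bprob (fun w => ([forall e in A :|: B, ~~ w e] : bool)%:R)).
  apply: eq_Ex => w; rewrite -natrM mulnb; congr (_%:R); congr nat_of_bool.
  apply/andP/forall_inP => [[/forall_inP hA /forall_inP hB] e|h].
    by rewrite inE => /orP[/hA|/hB].
  by split; apply/forall_inP => e he; apply: h; rewrite inE he ?orbT.
rewrite Ex_indep_pairs; last by move=> e; rewrite !inE => /orP[] /andP[].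
rewrite expr2 -!expRD -[X in _ = expR (- X + _ + _)](sum_pairs_img _ ft).
rewrite -[X in _ = expR (_ - X + _)](sum_pairs_img _ gt) -(sum_pairs_img _ ft) -imgI // -pairsI -/A -/B.
congr expR; set F := fun e : V * V => k (th e.1) (th e.2).
rewrite (big_setID A) /= setIUl setIid (setUidPl (subsetIr _ _)) setDUl setDv set0U.
by rewrite [X in _ = _ - X + _](big_setID A) /= (setIC B); ring.
Qed.

Definition good w : {set {ffun J -> V}} :=
  [set f in trans | indep w (img f [set: J])].

Lemma in_good w f :
  (f \in good w) = (f \in trans) && indep w (img f [set: J]).
Proof. by rewrite /good in_set. Qed.

Definition packing w (F : {set {ffun J -> V}}) :=
  (F \subset good w) && [forall f in F, forall g in F, conflict f g ==> (f == g)].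

Definition maxpack w : nat := \max_(F : {set {ffun J -> V}} | packing w F) #|F|.

Lemma card_le_maxpack w F : packing w F -> (#|F| <= maxpack w)%N.
Proof. exact: (@leq_bigmax_cond _ (packing w) (fun F => #|F|)). Qed.

Lemma packing0 w : packing w set0.
Proof.
by rewrite /packing sub0set /=; apply/forall_inP => f; rewrite inE.
Qed.

Lemma maxpack_attained w : exists2 F, packing w F & maxpack w = #|F|.
Proof.
have [|F] := @eq_bigmax_cond _ (packing w) (fun F => #|F|); last by exists F.
by apply/card_gt0P; exists set0; exact: packing0.
Qed.

(** Two members of a packing through the same pair [e] would agree in two slots, so dropping the
    members that use [e] loses at most one. *)
Lemma maxpack_lips : lips1 (fun w => (maxpack w)%:R : R).
Proof.
move=> w e b b'; rewrite natr1 ler_nat.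
have [F /andP[Fg /forall_inP Fc] ->] := maxpack_attained (upd w e b).
pose E := [set f in F | e \in pairs (img f [set: J])].
have E1 : (#|E| <= 1)%N.
  apply/card_le1P => f fE g; rewrite [g \in pred1 _]inE [LHS]inE.
  apply/idP/eqP => [/andP[gF ge]|->]; last by move: fE; rewrite inE.
  move: fE; rewrite inE => /andP[fF fe].
  have fg := Fc _ fF; move/forall_inP/(_ _ gF)/implyP in fg.
  symmetry; apply/eqP/fg; rewrite /conflict.
  have ft : f \in trans by have := subsetP Fg f fF; rewrite in_good => /andP[].
  have gt : g \in trans by have := subsetP Fg g gF; rewrite in_good => /andP[].
  have : e \in pairs (img f (agree f g)) by rewrite -imgI // -pairsI inE fe.
  rewrite inE => /and3P[elt e1 e2].
  rewrite -(card_imset (mem (agree f g)) (trans_inj ft)).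
  apply/card_gt1P; exists e.1, e.2; split => //.
  by apply: contraTneq elt => ->; rewrite ltnn.
have FE : packing (upd w e b') (F :\: E).
  apply/andP; split.
    apply/subsetP => f; rewrite inE => /andP[fE fF].
    have := subsetP Fg f fF; rewrite in_good => /andP[ft /indepP fi]; rewrite in_good; apply/andP; split; first exact: ft.
    apply/indepP => x xf; have := fi x xf; rewrite !ffunE.
    case: eqP => // xe; move: fE; rewrite inE fF /= -xe xf //.
  apply/forall_inP => f; rewrite inE => /andP[_ fF]; apply/forall_inP => g.
  by rewrite inE => /andP[_ gF]; apply: (forall_inP (Fc _ fF)).
have := card_le_maxpack FE.
have := cardsD F E; have := subset_leq_card (subsetIr F E).
by lia.
Qed.

Lemma maxpack_antitone : antitone (fun w => (maxpack w)%:R : R).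
Proof.
move=> w e; rewrite ler_nat.
have [F /andP[Fg Fc] ->] := maxpack_attained (upd w e true).
suff /card_le_maxpack : packing (upd w e false) F by [].
rewrite /packing Fc andbT; apply/subsetP => f /(subsetP Fg).
rewrite in_good => /andP[ft /indepP h]; rewrite in_good; apply/andP; split; first exact: ft.
by apply/indepP => x /h; rewrite !ffunE; case: eqP.
Qed.

Hypothesis J2 : (1 < #|J|)%N.

(** [turan] for the conflict graph on the edgeless transversals. The same [c] serves every [w], so
    expectations can be taken term by term. *)
Lemma maxpack_ge w (c : R) :
  2 * c * (\sum_(f in trans) (indep w (img f [set: J]))%:R) -
  c ^+ 2 * (\sum_(f in trans) \sum_(g in trans)
    (conflict f g)%:R * ((indep w (img f [set: J]))%:R * (indep w (img g [set: J]))%:R))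
  <= (maxpack w)%:R.
Proof.
have cr : reflexive conflict.
  move=> f; rewrite /conflict; suff -> : agree f f = [set: J] by rewrite cardsT.
  by apply/setP => j; rewrite !inE eqxx.
have cs : symmetric conflict.
  by move=> f g; rewrite /conflict; have -> : agree f g = agree g f by apply/setP => j; rewrite !inE eq_sym.
have [S [Sg Sc h]] := turan c (good w) cr cs.
have goodE (F : {ffun J -> V} -> R) : \sum_(f in good w) F f =
    \sum_(f in trans) (indep w (img f [set: J]))%:R * F f.
  rewrite (eq_bigl (fun f => (f \in trans) && indep w (img f [set: J]))).
    rewrite big_mkcondr; apply: eq_bigr => f _.
    by case: ifP => _; rewrite ?mul1r ?mul0r.
  by move=> f; rewrite in_good.
have SS : (#|S| <= maxpack w)%N.
  apply: card_le_maxpack; rewrite /packing Sg /=.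
  apply/forall_inP => f fS; apply/forall_inP => g gS; apply/implyP => fg.
  by apply/eqP; apply: Sc.
apply: (@le_trans _ _ #|S|%:R); last by rewrite ler_nat.
apply: le_trans h; rewrite le_eqVlt; apply/orP; left; apply/eqP.
congr (_ - _); congr (_ * _).
  by rewrite -[in RHS]sum1_card natr_sum goodE; apply: eq_bigr => f _; rewrite mulr1.
rewrite goodE; apply: eq_bigr => f _; rewrite goodE mulr_sumr; apply: eq_bigr => g _.
by ring.
Qed.

Variable u : R.
Hypothesis u0 : 0 < u.
Hypothesis part_ge : forall j, u <= #|[set v | lab v == Some j]|%:R.

(* Bounds E[conflicting pairs] / E[number of independent transversals]^2: two
   transversals agree on a given I with probability at most u^-|I|, which gains
   a factor exp(kap I) in the joint probability of independence. *)
Definition secsum : R := \sum_(I : {set J} | (1 < #|I|)%N) (u ^- #|I|) * expR (kap I).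

(** Prescribing the vertex of a slot in [I] divides the number of choices by the size of its part,
    which is at least [u]. *)
Lemma card_trans_agree f (I : {set J}) : f \in trans ->
  #|[set g in trans | I \subset agree f g]|%:R <= #|trans|%:R * u ^- #|I|.
Proof.
move=> ft; pose part j : pred V := [pred v | lab v == Some j].
have famE (P : J -> pred V) : #|family P| = (\prod_j #|P j|)%N.
  by rewrite card_family foldrE big_image.
have tE : #|trans| = (\prod_j #|part j|)%N.
  rewrite -famE; apply: eq_card => g; rewrite inE.
  apply/forallP/familyP => h j; have := h j; by rewrite inE.
pose part' j : pred V := if j \in I then (pred1 (f j) : pred V) else part j.
have -> : #|[set g in trans | I \subset agree f g]| = (\prod_j #|part' j|)%N.
  rewrite -famE; apply: eq_card => g; rewrite !inE.
  apply/andP/familyP => [[/forallP h1 /subsetP h2] j|h].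
    rewrite /part'; case: ifP => jI; last by rewrite inE.
    by have := h2 _ jI; rewrite !inE eq_sym.
  split; [apply/forallP => j|apply/subsetP => j jI]; have := h j; rewrite /part'.
    by case: ifP => _; rewrite inE // => /eqP ->; rewrite transP.
  by rewrite jI !inE eq_sym.
have -> : u ^- #|I| = \prod_j (if j \in I then u^-1 else 1).
  by rewrite -big_mkcond /= prodr_const exprVn.
rewrite tE !natr_prod -big_split /=; apply: ler_prod => j _; rewrite ler0n /= /part'.
case: ifP => _; last by rewrite mulr1.
by rewrite card1 ler_pdivlMr // mul1r; have := part_ge j; rewrite cardsE.
Qed.

Lemma sum_conflict :
  \sum_(f in trans) \sum_(g in trans) (conflict f g)%:R * expR (kap (agree f g))
  <= #|trans|%:R ^+ 2 * secsum.
Proof.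
have h f : f \in trans ->
   \sum_(g in trans) (conflict f g)%:R * expR (kap (agree f g)) <= #|trans|%:R * secsum.
  move=> ft; rewrite /secsum mulr_sumr.
  rewrite (partition_big (agree f) predT) //= [leRHS]big_mkcond /=.
  apply: ler_sum => I _.
  rewrite (eq_bigr (fun=> (1 < #|I|)%N%:R * expR (kap I))); last first.
    by move=> g /andP[_ /eqP <-].
  case: ifP => [I1|_]; last by rewrite big1 // => g _; rewrite mul0r.
  rewrite mul1r sumr_const -[leLHS]mulr_natl [leRHS]mulrA ler_wpM2r ?expR_ge0 //.
  (* Having [I] as exact agreement set is relaxed to agreeing at least on [I]. *)
  apply: le_trans (card_trans_agree I ft); rewrite ler_nat.
  apply: subset_leq_card; apply/subsetP => g /andP[gt /eqP <-].
  by rewrite in_set gt subxx.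
apply: (@le_trans _ _ (\sum_(f in trans) #|trans|%:R * secsum)).
  by apply: ler_sum.
by rewrite sumr_const -[leLHS]mulr_natl expr2 mulrA.
Qed.

Lemma Ex_maxpack_ge p : is_proba p -> (forall e, p e <= bprob e) ->
  0 < secsum -> secsum^-1 <= Ex p (fun w => (maxpack w)%:R).
Proof.
move=> hp pb s0.
apply: le_trans (Ex_antitone hp bprob_proba pb maxpack_antitone).
have tpos : (0 < #|trans|)%N.
  have pne j : exists v, lab v == Some j.
    have : (0 < #|[set v | lab v == Some j]|)%N.
      by rewrite -(ltr_nat R) (lt_le_trans u0).
    by move=> /card_gt0P[v]; rewrite inE; exists v.
  apply/card_gt0P; exists [ffun j => xchoose (pne j)]; rewrite inE.
  by apply/forallP => j; rewrite ffunE; exact: (xchooseP (pne j)).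
pose rho := expR (- kap [set: J]).
have rho0 : 0 < rho by exact: expR_gt0.
have t0 : 0 < #|trans|%:R :> R by rewrite ltr0n.
(* The maximiser of [2 c X - c^2 Y] for [X = #|trans| rho] and [Y = (#|trans| rho)^2 secsum]; the
   maximum is [X^2 / Y = secsum^-1]. *)
pose c := (#|trans|%:R * rho * secsum)^-1.
have := ler_Ex bprob_proba (fun w => maxpack_ge w c).
rewrite ExB !ExZ !Ex_sum => h; apply: le_trans h.
have e1 : \sum_(f in trans) Ex bprob (fun w => (indep w (img f [set: J]))%:R) = #|trans|%:R * rho.
  by rewrite (eq_bigr (fun=> rho)) ?sumr_const ?mulr_natl // => f ft; rewrite Ex_indep.
have e2 : \sum_(f in trans) Ex bprob (fun w => \sum_(g in trans)
    (conflict f g)%:R * ((indep w (img f [set: J]))%:R * (indep w (img g [set: J]))%:R))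
  <= rho ^+ 2 * (#|trans|%:R ^+ 2 * secsum).
  apply: (@le_trans _ _ (rho ^+ 2 * \sum_(f in trans) \sum_(g in trans)
      (conflict f g)%:R * expR (kap (agree f g)))); last first.
    by rewrite ler_wpM2l ?sqr_ge0 // sum_conflict.
  rewrite mulr_sumr le_eqVlt; apply/orP; left; apply/eqP.
  apply: eq_bigr => f ft; rewrite Ex_sum mulr_sumr; apply: eq_bigr => g gt.
  by rewrite ExZ Ex_indep2 // mulrCA.
rewrite e1; apply: le_trans (lerB (lexx _) (ler_wpM2l (sqr_ge0 c) e2)).
rewrite le_eqVlt; apply/orP; left; apply/eqP; rewrite /c; field.
by rewrite !lt0r_neq0.
Qed.

(** Without edgeless transversals [maxpack] is 0, a lower-tail event for a 1-Lipschitz function of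
    [n ^ 2] coordinates. *)
Lemma prob_good0 p (t : R) : is_proba p -> (forall e, p e <= bprob e) ->
  0 < secsum -> 0 <= t <= 2^-1 ->
  Ex p (fun w => (good w == set0)%:R) <= expR (t ^+ 2 * n%:R ^+ 2 - t / secsum).
Proof.
move=> hp pb s0 t01.
have := Ex_tail hp maxpack_lips t01 (Ex_maxpack_ge hp pb s0).
rewrite card_prod card_ord natrM -expr2; apply: le_trans.
apply: ler_Ex => // w; rewrite ler_nat.
case: eqP => // g0; suff -> : maxpack w = 0%N by rewrite lexx.
rewrite /maxpack; apply/eqP; rewrite -leqn0; apply/bigmax_leqP => F /andP[].
by rewrite g0 subset0 => /eqP -> _; rewrite cards0.
Qed.

End Transversals.

End FiniteSets.

(** * Size of the second moment sum and the resulting failure probability *)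

Section KeyEstimate.
Import mathcomp.boot.fintype mathcomp.boot.finset.
Variables (R : realType) (T J : finType) (sg : J -> T) (k : T -> T -> R).
(** [L] stands for log n, as [L_def] says below, and [c] is the slack in the exponents; [J_u] asks
    for parts of size at least [#|J| n^(1 - c/2)]. *)
Variables (K c L u : R).
Hypothesis k_bnd : forall a b, 0 <= k a b <= K.
Hypothesis c_bnd : 0 < c <= 8^-1.
Hypothesis L_big : 16 + 64 * K / c ^+ 2 <= L.
Hypothesis u0 : 0 < u.
Hypothesis J2 : (1 < #|J|)%N.
Hypothesis J_u : #|J|%:R <= u * expR (- (1 - c / 2) * L).
Hypothesis kap_le : forall I : {set J}, kap sg k I <= (1 - c) * #|I|%:R * L.

Lemma kap_le_sq (I : {set J}) : kap sg k I <= K * #|I|%:R ^+ 2 / 2.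
Proof.
rewrite /kap ler_wpM2r ?invr_ge0 // expr2 mulrCA mulr_natl -sumr_const.
apply: ler_sum => i iI; rewrite mulrC mulr_natl -sumr_const big_mkcondr /=.
apply: ler_sum => j jI; case/andP: (k_bnd (sg i) (sg j)) => k0 kK.
by case: ifP => // _; exact: le_trans kK.
Qed.

Lemma secsum_gt0 : 0 < secsum sg k u.
Proof.
rewrite /secsum (bigD1 [set: J]) /=; last by rewrite cardsT.
apply: ltr_wpDr; last by rewrite mulr_gt0 ?expR_gt0 // invr_gt0 exprn_gt0.
by apply: sumr_ge0 => I _; rewrite mulr_ge0 ?expR_ge0 // invr_ge0 exprn_ge0 // ltW.
Qed.

(* For |I| >= 4 / c the linear bound on [kap I] is used, for smaller |I| the
   quadratic one, which is then a constant. *)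
Lemma kap_exponent (I : {set J}) : (1 < #|I|)%N ->
  kap sg k I + 1 + 7 / 4 * L <= (1 - c / 2) * L * #|I|%:R.
Proof.
move=> I1; have i2 : 2 <= #|I|%:R :> R by rewrite (ler_nat R 2).
have h1 := kap_le I; have h2 := kap_le_sq I; move: i2 h1 h2.
set i := #|I|%:R; set x := kap _ _ _ => i2 h1 h2.
case/andP: c_bnd => c0 c8.
have K0 : 0 <= K by case/card_gt0P: (ltnW J2) => j _; case/andP: (k_bnd (sg j) (sg j)) => /le_trans; apply.
have c20 : 0 < c ^+ 2 by rewrite exprn_gt0.
have KC0 : 0 <= K / c ^+ 2 by rewrite divr_ge0 // ltW.
have L16 : 16 <= L by move: L_big; rewrite -mulrA; lra.
have [ic|ic] := lerP (4 / c) i.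
  (* The two linear rates differ by [c/2 L] per slot, so the gain is at least [2 L]. *)
  have ic' : 4 <= i * c by move: ic; rewrite ler_pdivrMr.
  have : L * 4 <= L * (i * c) by rewrite ler_wpM2l //; lra.
  by lra.
have ic' : i * c <= 4 by move: ic; rewrite ltr_pdivlMr // => /ltW.
have h3 : K * i ^+ 2 <= 16 * (K / c ^+ 2).
  rewrite mulrA ler_pdivlMr // -mulrA -exprMn mulrC.
  rewrite ler_wpM2r //; have : 0 <= i * c by apply: mulr_ge0; lra.
  by nra.
have h4 : x <= 8 * (K / c ^+ 2) by lra.
(* From [#|I| >= 2] and [c <= 1/8]. The margin [L / 8] over [7/4 L] pays for 1 and for the constant
   [8 K / c^2]; this is the origin of [L_big]. *)
have h5 : 15 / 8 * L <= (1 - c / 2) * L * i.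
  rewrite [leRHS]mulrAC ler_wpM2r //; first by lra.
  by apply: le_trans (ler_wpM2l (_ : 0 <= 1 - c / 2) i2); lra.
by move: L_big; rewrite -mulrA; lra.
Qed.

(** Each term is at most [#|J|^(-#|I|) exp(-1 - 7/4 L)] by [kap_exponent]. Summed over all subsets,
    [#|J|^(-#|I|)] gives [(1 + 1/#|J|)^#|J| <= e], which the spare 1 in the exponent cancels. *)
Lemma secsum_le : secsum sg k u <= expR (- (7 / 4 * L)).
Proof.
have h0 : 0 < #|J|%:R :> R by rewrite ltr0n ltnW.
have sumE (x : R) : \sum_(I : {set J}) x ^+ #|I| = (1 + x) ^+ #|J|.
  rewrite -prodr_const addrC (@bigA_distr _ _ _ _ _ _ (fun=> x) (fun=> 1)) /=.
  apply: eq_bigr => I _; rewrite -big_mkcond /= prodr_const //.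
have e1 : (1 + #|J|%:R^-1) ^+ #|J| <= expR 1 :> R.
  have -> : expR 1 = expR #|J|%:R^-1 ^+ #|J| :> R.
    by rewrite -expRM_natl divff // lt0r_neq0.
  rewrite lerXn2r ?nnegrE ?expR_ge0 ?expR_ge1Dx //.
apply: (@le_trans _ _ (expR (- (1 + 7 / 4 * L)) * \sum_(I : {set J}) #|J|%:R^-1 ^+ #|I|)); last first.
  rewrite sumE; apply: le_trans (ler_wpM2l (expR_ge0 _) e1) _.
  by rewrite -expRD ler_expR; lra.
rewrite mulr_sumr /secsum [leLHS]big_mkcond /=; apply: ler_sum => I _.
case: ifP => [I1|_]; last first.
  by rewrite mulr_ge0 ?expR_ge0 // exprn_ge0 // invr_ge0 ltW.
have u1 : u^-1 <= #|J|%:R^-1 * expR (- (1 - c / 2) * L).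
  by rewrite ler_pdivlMl // ler_pdivrMr // mulrC.
have u2 : u ^- #|I| <= #|J|%:R^-1 ^+ #|I| * expR (- (1 - c / 2) * L * #|I|%:R).
  rewrite expRM_natr -exprMn -exprVn lerXn2r // nnegrE ?invr_ge0 ?ltW //.
  by rewrite mulr_gt0 ?expR_gt0 ?invr_gt0.
apply: (le_trans (ler_wpM2r (expR_ge0 _) u2)); rewrite -[leLHS]mulrA [leLHS]mulrC.
apply: ler_wpM2r; first by rewrite exprn_ge0 // invr_ge0.
by rewrite -expRD ler_expR; have := kap_exponent I1; lra.
Qed.

Variables (n : nat) (th : 'I_n -> T) (lab : 'I_n -> option J).
Hypothesis L_def : expR L = n%:R.
Hypothesis ksym : forall a b, k a b = k b a.
Hypothesis th_lab : forall v j, lab v = Some j -> th v = sg j.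
Hypothesis part_ge : forall j, u <= #|[set v | lab v == Some j]|%:R.

Lemma prob_no_transversal p : is_proba p ->
  (forall e, p e <= bprob th k e) ->
  Ex p (fun w => (good lab w == set0)%:R) <= expR (- (expR (3 / 2 * L) / 4)).
Proof.
move=> hp pb; case/andP: c_bnd => c0 c8.
have K0 : 0 <= K by case/card_gt0P: (ltnW J2) => j _; case/andP: (k_bnd (sg j) (sg j)) => /le_trans; apply.
have KC0 : 0 <= K / c ^+ 2 by rewrite divr_ge0 // sqr_ge0.
have L16 : 16 <= L by move: L_big; rewrite -mulrA; lra.
have k0 a b : 0 <= k a b by case/andP: (k_bnd a b).
(* [n^(-1/4) / 2] minimises [t^2 n^2 - t n^(7/4)], with value [- n^(3/2) / 4]. *)
pose t := expR (- (1 / 4 * L)) / 2.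
have t01 : 0 <= t <= 2^-1.
  rewrite /t mulr_ge0 ?expR_ge0 ?invr_ge0 //= ler_pdivrMr // mulVf //.
  by rewrite expR_le1; lra.
have := prob_good0 ksym k0 th_lab J2 u0 part_ge hp pb secsum_gt0 t01.
move=> /le_trans; apply; rewrite ler_expR.
have s1 : expR (7 / 4 * L) <= (secsum sg k u)^-1.
  have -> : expR (7 / 4 * L) = (expR (- (7 / 4 * L)))^-1 by rewrite expRN invrK.
  rewrite lef_pV2 ?posrE ?secsum_gt0 ?expR_gt0 //; exact: secsum_le.
have t0 : 0 <= t by case/andP: t01.
apply: le_trans (lerB (lexx _) (ler_wpM2l t0 s1)) _.
have e1 : t ^+ 2 * n%:R ^+ 2 = expR (3 / 2 * L) / 4.
  rewrite -L_def -exprMn /t mulrAC -expRD exprMn -expRM_natl.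
  have -> : 2 * (- (1 / 4 * L) + L) = 3 / 2 * L by field.
  by congr (_ * _); field.
have e2 : t * expR (7 / 4 * L) = expR (3 / 2 * L) / 2.
  by rewrite /t mulrAC -expRD; congr (expR _ / _); field.
by rewrite e1 e2; lra.
Qed.

End KeyEstimate.

(** * Slots built from a profile of types *)

Section Slots.
Import mathcomp.boot.fintype mathcomp.boot.finset.
Variables (R : realType) (T : finType) (k : T -> T -> R).
Hypothesis kge0 : forall a b, 0 <= k a b.

(* A point r of the box is the mean of a random vertex of the box with
   independent coordinates, and the quadratic form can only increase in mean
   because its diagonal coefficients are nonnegative. *)
Lemma box_quadratic (m r : T -> R) (B : R) :
  (forall S : {set T}, \sum_(a in S) \sum_(b in S) m a * m b * k a b <=
     B * \sum_(a in S) m a) ->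
  (forall a, 0 <= r a <= m a) ->
  \sum_a \sum_b r a * r b * k a b <= B * \sum_a r a.
Proof.
move=> hS hr.
pose q a := r a / m a.
have m0 a : 0 <= m a by case/andP: (hr a) => /le_trans; apply.
have qm a : r a = q a * m a.
  rewrite /q; have [e|ne] := eqVneq (m a) 0; last by rewrite divfK.
  by rewrite e mulr0; apply/eqP; rewrite eq_le -{1}e; case/andP: (hr a) => -> ->.
have q01 a : 0 <= q a <= 1.
  case/andP: (hr a) => r0 rm; rewrite /q divr_ge0 //=.
  have [e|ne] := eqVneq (m a) 0; first by rewrite e invr0 mulr0.
  by rewrite ler_pdivrMr ?mul1r // lt_neqAle eq_sym ne m0.
(* Type [a] is selected when [w a] is false, which has probability [q a]; this way round the moments
   are instances of [Ex_none]. *)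
pose p a := 1 - q a.
have hp : is_proba p by move=> a; rewrite /p; case/andP: (q01 a) => ? ?; lra.
pose X a (w : {ffun T -> bool}) : R := ([forall e in [set a], ~~ w e] : bool)%:R.
pose Y a b (w : {ffun T -> bool}) : R := ([forall e in [set a; b], ~~ w e] : bool)%:R.
have XE a w : X a w = (~~ w a)%:R.
  by rewrite /X; congr (nat_of_bool _)%:R; apply/forall_inP/idP => [|h e];
    [apply; rewrite inE|rewrite inE => /eqP ->].
have YE a b w : Y a b w = (~~ w a)%:R * (~~ w b)%:R.
  rewrite -natrM mulnb /Y; congr (nat_of_bool _)%:R; apply/forall_inP/andP.
    by move=> h; split; apply: h; rewrite !inE eqxx ?orbT.
  by move=> [ha hb] e; rewrite !inE => /orP[] /eqP ->.
have EX a : Ex p (X a) = q a.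
  by rewrite Ex_none big_set1 /p; ring.
have EY a b : q a * q b <= Ex p (Y a b).
  rewrite Ex_none; have [<-|ab] := eqVneq a b.
    rewrite setUid big_set1 /p; case/andP: (q01 a) => ? ?; nra.
  by rewrite big_setU1 ?inE //= big_set1 /p le_eqVlt; apply/orP; left; apply/eqP; ring.
have h := @ler_Ex R T p (fun w => \sum_a \sum_b m a * m b * k a b * Y a b w)
  (fun w => B * \sum_a m a * X a w) hp.
have hh : forall w : {ffun T -> bool}, \sum_a \sum_b m a * m b * k a b * Y a b w <= B * \sum_a m a * X a w.
  move=> w; have := hS [set a | ~~ w a].
  have e1 : \sum_a m a * X a w = \sum_(a in [set a | ~~ w a]) m a.
    rewrite [RHS]big_mkcond; apply: eq_bigr => a _; rewrite inE XE.
    by case: (w a); rewrite ?mulr0 ?mulr1.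
  rewrite e1; apply: le_trans; rewrite le_eqVlt; apply/orP; left; apply/eqP.
  rewrite [RHS]big_mkcond; apply: eq_bigr => a _; rewrite inE.
  case: ifP => wa; last by rewrite big1 // => b _; rewrite YE wa mul0r mulr0.
  rewrite [RHS]big_mkcond; apply: eq_bigr => b _; rewrite inE YE wa mul1r.
  by case: (w b); rewrite ?mulr0 ?mulr1.
have {h hh} := h hh.
rewrite ExZ !Ex_sum => h; apply: le_trans (le_trans _ h) _.
  apply: ler_sum => a _; rewrite Ex_sum; apply: ler_sum => b _.
  rewrite ExZ !qm [leLHS](_ : _ = m a * m b * k a b * (q a * q b)); last by ring.
  by rewrite ler_wpM2l // !mulr_ge0.
rewrite le_eqVlt; apply/orP; left; apply/eqP; congr (_ * _).
by apply: eq_bigr => a _; rewrite ExZ EX qm mulrC.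
Qed.

Section SlotType.
Variables (l : T -> nat) (La : nat) (S : {set T}).

(** [La] is a common bound on the [l a] that makes the indices range over a finite type; [S] will be
    the set of types still in good supply. *)
Definition slot := {x : T * 'I_La | (x.1 \in S) && (x.2 < l x.1)%N}.

Definition slot_type (j : slot) : T := (val j).1.

Lemma card_slot_type (I : {set slot}) a :
  (#|[set j in I | slot_type j == a]| <= l a)%N.
Proof.
case: (posnP (l a)) => [l0|lp].
  rewrite l0 leqn0 cards_eq0; apply/eqP/setP => j; rewrite in_set in_set0.
  apply/negP => /andP[_ /eqP ja]; have /andP[_] := valP j.
  by rewrite -/(slot_type j) ja l0.
rewrite -[leqRHS]card_ord.
pose f (j : slot) : 'I_(l a) := insubd (Ordinal lp) (val (val j).2).
rewrite -(@card_in_imset _ _ f) ?max_card // => i j.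
rewrite !in_set => /andP[_ /eqP ia] /andP[_ /eqP ja] e.
have /andP[_] := valP i; rewrite -/(slot_type i) ia => hi.
have /andP[_] := valP j; rewrite -/(slot_type j) ja => hj.
apply/val_inj; rewrite [val i]surjective_pairing [val j]surjective_pairing.
congr pair; first by rewrite -/(slot_type i) -/(slot_type j) ia ja.
by apply/val_inj; move: (congr1 val e); rewrite /f !val_insubd hi hj.
Qed.

Lemma card_slot_le : (#|{: slot}| <= #|T| * La)%N.
Proof. by rewrite card_sig -[La in leqRHS]card_ord -card_prod max_card. Qed.

(** A set [I] of slots uses [A r a] slots of type [a] with [r] in the box below [m]. After adding
    the nonnegative diagonal terms, [box_quadratic] carries the hypothesis on unions of types over
    to every sub-profile. *)
Lemma kap_slot_le (m : T -> R) (B A : R) (I : {set slot}) : 0 < A ->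
  (forall S : {set T}, \sum_(a in S) \sum_(b in S) m a * m b * k a b <=
     B * \sum_(a in S) m a) ->
  (forall a, (l a)%:R <= m a * A) ->
  kap slot_type k I <= A * B / 2 * #|I|%:R.
Proof.
move=> A0 hS hl; pose r a : R := #|[set j in I | slot_type j == a]|%:R / A.
have cI (F : T -> R) : \sum_(j in I) F (slot_type j) = A * \sum_a r a * F a.
  rewrite (partition_big slot_type predT) //= mulr_sumr; apply: eq_bigr => a _.
  rewrite (eq_bigr (fun=> F a)); last by move=> j /andP[_ /eqP ->].
  rewrite sumr_const -mulr_natl mulrA /r mulrCA divff ?lt0r_neq0 // mulr1.
  by congr (_%:R * _); apply: eq_card => j; rewrite [RHS]inE.
have hr a : 0 <= r a <= m a.
  rewrite /r divr_ge0 ?(ltW A0) //= ler_pdivrMr //.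
  by apply: le_trans (hl a); rewrite ler_nat card_slot_type.
have h := box_quadratic hS hr.
rewrite /kap mulrAC ler_wpM2r ?invr_ge0 //.
apply: (@le_trans _ _ (\sum_(i in I) \sum_(j in I) k (slot_type i) (slot_type j))).
  apply: ler_sum => i _; rewrite [leRHS](bigID (fun j => j != i)) /= lerDl.
  by apply: sumr_ge0.
have e1 : #|I|%:R = A * \sum_a r a.
  rewrite -sum1_card natr_sum (cI (fun=> 1)); congr (_ * _).
  by apply: eq_bigr => a _; rewrite mulr1.
rewrite e1 (eq_bigr (fun i => A * \sum_b r b * k (slot_type i) b)); last first.
  by move=> i _; rewrite (cI (fun b => k (slot_type i) b)).
rewrite -mulr_sumr (cI (fun a => \sum_b r b * k a b)) -!mulrA ler_wpM2l ?(ltW A0) //.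
rewrite mulrCA ler_wpM2l ?(ltW A0) //; apply: le_trans h.
rewrite le_eqVlt; apply/orP; left; apply/eqP.
by apply: eq_bigr => a _; rewrite mulr_sumr; apply: eq_bigr => b _; ring.
Qed.

End SlotType.
End Slots.

Section Greedy.
Import mathcomp.boot.fintype mathcomp.boot.finset.

(** * Greedy colouring *)

(** Consecutive blocks of the enumeration of [B] will serve as disjoint parts; this certifies that
    block [x] is full. *)
Lemma card_index_block (V : finType) (B : {set V}) (x u : nat) : (0 < u)%N ->
  (x.+1 * u <= #|B|)%N ->
  (u <= #|[set v in B | index v (enum B) %/ u == x]|)%N.
Proof.
move=> u0 xu.
have lt_r (r : 'I_u) : (x * u + r < size (enum B))%N.
  by rewrite -cardE; apply: leq_trans xu; rewrite mulSn addnC ltn_add2r.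
have [v0 _] : exists v0, v0 \in B.
  by apply/card_gt0P; apply: leq_trans xu; rewrite muln_gt0.
pose g (r : 'I_u) := nth v0 (enum B) (x * u + r).
have ig r : index (g r) (enum B) = (x * u + r)%N.
  by rewrite index_uniq ?lt_r ?enum_uniq.
rewrite -[leqLHS]card_ord -(@card_in_imset _ _ g predT); last first.
  by move=> r s _ _ /(congr1 (index^~ (enum B))); rewrite !ig => /addnI /val_inj.
apply: subset_leq_card; apply/subsetP => _ /imsetP[r _ ->]; rewrite inE.
rewrite -mem_enum mem_nth ?lt_r //= ig divnMDl // divn_small ?addn0 //.
Qed.

Variables (n : nat) (T : finType) (th : 'I_n -> T).
Local Notation V := 'I_n.
Implicit Types (w : {ffun V * V -> bool}) (U : {set V}).

Definition edge w (x y : V) :=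
  ((x < y)%N && w (x, y)) || ((y < x)%N && w (y, x)).

Lemma edge_sym w : symmetric (edge w).
Proof. by move=> x y; rewrite /edge orbC. Qed.

Lemma edge_irr w : irreflexive (edge w).
Proof. by move=> x; rewrite /edge ltnn. Qed.

Definition graph_of w : sgraph V := SGraph (@edge_sym w) (@edge_irr w).

Definition colored_off w U t := exists c : V -> nat,
  (forall v, v \notin U -> (c v < t)%N) /\
  (forall x y, x \notin U -> y \notin U -> edge w x y -> c x <> c y).

Lemma colored_off_step w U (A : {set V}) t : indep w A ->
  colored_off w U t -> colored_off w (U :\: A) t.+1.
Proof.
move=> /indepP Ai [c [ct cU]].
have nA x y : x \in A -> y \in A -> ~~ edge w x y.
  move=> xA yA; apply/negP => /orP[] /andP[xy];
    by apply/negP; apply: Ai; rewrite inE /= xy ?xA yA.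
exists (fun v => if v \in A then t else c v); split.
  move=> v; rewrite inE negb_and negbK => /orP[->//|vU].
  by case: ifP => // _; apply: ltnW; apply: ct.
move=> x y; rewrite !inE !negb_and !negbK => xU yU xy.
case: ifP xU => /= xA xU; case: ifP yU => /= yA yU.
- by move: xy; rewrite (negbTE (nA _ _ xA yA)).
- by move=> e; have := ct _ yU; rewrite -e ltnn.
- by move=> e; have := ct _ xU; rewrite e ltnn.
- exact: cU.
Qed.

Lemma chi_colored_off0 w t : colored_off w set0 t -> (chi (graph_of w) <= t)%N.
Proof.
move=> [c [ct cU]]; rewrite /chi; case: ex_minnP => x _; apply.
have ct' v : (c v < t)%N by apply: ct; rewrite inE.
apply/existsP; exists [ffun v => Ordinal (ct' v)]; apply/forallP => x1.
apply/forallP => x2; apply/implyP => e; rewrite !ffunE; apply/eqP => -[].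
by apply: cU => //; rewrite inE.
Qed.

Lemma chi_colored_off w U t : colored_off w U t ->
  (chi (graph_of w) <= t + #|U|)%N.
Proof.
move: {2}#|U| (erefl #|U|) => N; elim: N U t => [|N IH] U t UN.
  by rewrite UN addn0; move/eqP: UN; rewrite cards_eq0 => /eqP ->; exact: chi_colored_off0.
move=> h; have [v vU] : exists v, v \in U by apply/card_gt0P; rewrite UN.
have iv : indep w [set v].
  by apply/indepP => e; rewrite !inE => /and3P[+ /eqP e1 /eqP e2]; rewrite e1 e2 ltnn.
have UvN : #|U :\ v| = N by move: (cardsD1 v U); rewrite vU UN => -[].
by have := IH _ _ UvN (colored_off_step iv h); rewrite UvN UN addSnnS.
Qed.

(** A type with fewer than [m] uncoloured vertices is passed over; by [l_m], [m] vertices fill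
    [l i a] parts of size [u]. By [l_ge] a single available type already offers the two slots that
    the second moment bound asks for. *)
Variables (Ix : finType) (l : Ix -> T -> nat) (La m u : nat).
Hypothesis u0 : (0 < u)%N.
Hypothesis l_le : forall i a, (l i a <= La)%N.
Hypothesis l_ge : forall i a, (1 < l i a)%N.
Hypothesis l_m : forall i a, (l i a * u <= m)%N.

Definition admissible (i : Ix) (S : {set T})
    (lab : {ffun V -> option (slot (l i) La S)}) :=
  [forall v, forall j, (lab v == Some j) ==> (th v == slot_type j)] &&
  [forall j, u <= #|[set v | lab v == Some j]|]%N.

(** Uniform over labellings because the uncoloured set reached by the greedy colouring depends on
    [w] itself. *)
Definition has_all_transversals w := forall i (S : {set T})
  (lab : {ffun V -> option (slot (l i) La S)}),
  (1 < #|{: slot (l i) La S}|)%N -> admissible lab ->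
  good lab w != set0.

Definition cell U a : {set V} := [set v in U | th v == a].

Definition block_index U v := (index v (enum (cell U (th v))) %/ u)%N.

(** Within each type the uncoloured vertices are dealt to the slots block by block; vertices of
    types outside [S], and those beyond the last block in use, get [None]. *)
Definition greedy_lab i U S v : option (slot (l i) La S) :=
  if v \in U then
    obind (fun o : 'I_La => (insub (th v, o) : option (slot (l i) La S)))
      (insub (block_index U v))
  else None.

Lemma greedy_labP i U S v (j : slot (l i) La S) :
  (greedy_lab i U S v == Some j) =
  [&& v \in U, th v == slot_type j & block_index U v == (val j).2].
Proof.
rewrite /greedy_lab; case: ifP => //= vU.
case: insubP => [z _ zE|h] /=; last first.
  by apply/esym/negP => /andP[_ /eqP e]; move: h; rewrite e ltn_ord.
rewrite -zE (inj_eq val_inj).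
apply/eqP/andP => [|[/eqP e1 /eqP e2]].
  case: insubP => [j' _ j'E [<-]|//].
  by rewrite -[sval j']/(val j') /slot_type j'E /= !eqxx.
have -> : (th v, z) = val j by rewrite e1 e2 /slot_type -surjective_pairing.
by rewrite valK.
Qed.

(** The new colour class is a transversal for the types with at least [m] vertices left; each of
    them loses its [l i a] picked vertices, while the other cells are below [m] already, whence the
    [maxn]. *)
Lemma greedy_step w i U t : has_all_transversals w -> colored_off w U t ->
  exists2 U', colored_off w U' t.+1 &
    forall a, (#|cell U' a| <= maxn m (#|cell U a| - l i a))%N.
Proof.
move=> hw hU; pose S := [set a | (m <= #|cell U a|)%N].
have [S0|[a0 a0S]] := set_0Vmem S.
  exists U.
    move: hU => [c [ct cU]]; exists c; split => // v /ct /ltnW; exact: leq_trans.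
  move=> a; rewrite leq_max; apply/orP; left; move/setP/(_ a): S0; rewrite !inE.
  by move/negbT; rewrite -ltnNge => /ltnW.
pose lab : {ffun V -> option (slot (l i) La S)} := [ffun v => greedy_lab i U S v].
have mk a x (aS : a \in S) (xl : (x < l i a)%N) : exists j : slot (l i) La S,
    slot_type j = a /\ (val j).2 = x :> nat.
  have xLa : (x < La)%N by apply: leq_trans (l_le i a).
  have P : ((a, Ordinal xLa).1 \in S) && ((a, Ordinal xLa).2 < l i (a, Ordinal xLa).1)%N.
    by rewrite /= aS xl.
  by exists (exist _ (a, Ordinal xLa) P).
have J2 : (1 < #|{: slot (l i) La S}|)%N.
  have [j0 [j0a j0x]] := mk _ _ a0S (ltnW (l_ge i a0)).
  have [j1 [j1a j1x]] := mk _ _ a0S (l_ge i a0).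
  by apply/card_gt1P; exists j0, j1; split => //; apply/eqP => e; rewrite e j1x in j0x.
have lab_adm : admissible lab.
  apply/andP; split.
    apply/forallP => v; apply/forallP => j; apply/implyP; rewrite ffunE greedy_labP.
    by case/and3P.
  apply/forallP => j; have /andP[jS jl] := valP j.
  have := @card_index_block _ (cell U (slot_type j)) (val j).2 u u0.
  have -> : [set v in cell U (slot_type j) | (index v (enum (cell U (slot_type j))) %/ u)%N == (val j).2]
    = [set v | lab v == Some j].
    apply/setP => v; rewrite !inE ffunE greedy_labP -andbA; congr andb.
    by case: eqP => //= tv; rewrite /block_index tv.
  apply; apply: (@leq_trans (l i (slot_type j) * u)); first by rewrite leq_mul2r jl orbT.
  by apply: leq_trans (l_m _ _) _; move: jS; rewrite inE.
have := hw i S lab J2 lab_adm => /set0Pn[f]; rewrite in_good => /andP[ft fi].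
exists (U :\: img f [set: _]); first exact: colored_off_step.
move=> a; have [aS|] := boolP (a \in S); last first.
  rewrite inE -ltnNge => h; rewrite leq_max; apply/orP; left.
  apply: leq_trans (ltnW h); apply: subset_leq_card; apply/subsetP => v.
  by rewrite !inE => /andP[/andP[_ ->] ->].
rewrite leq_max; apply/orP; right.
pose A := [set f j | j in [set j | slot_type j == a]].
have fj j : [/\ f j \in U, th (f j) = slot_type j & block_index U (f j) = (val j).2].
  have := transP j ft; rewrite ffunE => /eqP; rewrite greedy_labP.
  by case/and3P => -> /eqP -> /eqP ->.
have AU : A \subset cell U a.
  apply/subsetP => _ /imsetP[j ja ->]; rewrite !inE in ja *.
  by case: (fj j) => -> -> _; rewrite ja.
have -> : cell (U :\: img f [set: _]) a = cell U a :\: A.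
  apply/setP => v; rewrite !inE; apply/andP/andP => [[/andP[vf vU] va]|[vA /andP[vU va]]].
    rewrite vU va; split => //; apply: contra vf => /imsetP[j _ ->].
    by apply/imsetP; exists j.
  rewrite vU va andbT; split => //; apply: contra vA => /imsetP[j _ e].
  apply/imsetP; exists j => //; rewrite inE; case: (fj j) => _ <- _.
  by rewrite -e.
rewrite cardsD (setIidPr AU) leq_sub2l //.
rewrite /A card_imset; last exact: (trans_inj ft).
rewrite -[leqLHS]card_ord.
have ex (x : 'I_(l i a)) : exists j : slot (l i) La S, (slot_type j == a) && ((val j).2 == x :> nat).
  by have [j [ja jx]] := mk _ _ aS (ltn_ord x); exists j; rewrite ja eqxx jx eqxx.
pose g x := xchoose (ex x).
have gP x : slot_type (g x) == a /\ (val (g x)).2 = x :> nat.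
  by case/andP: (xchooseP (ex x)) => -> /eqP ->.
rewrite -(@card_in_imset _ _ g predT); last first.
  move=> x y _ _ e; apply/val_inj.
  have [_ gx] := gP x; have [_ gy] := gP y.
  by transitivity (nat_of_ord (val (g x)).2); [rewrite gx|rewrite e gy].
apply: subset_leq_card; apply/subsetP => _ /imsetP[x _ ->]; rewrite inE.
by case: (gP x).
Qed.

(** After [t i] rounds of every profile the difference in the [maxn] is 0, so at most [m] vertices
    of each type remain, and each of these gets a colour of its own. *)
Lemma greedy_chi w (t : Ix -> nat) : has_all_transversals w ->
  (forall a, #|cell [set: V] a| <= \sum_i t i * l i a)%N ->
  (chi (graph_of w) <= (\sum_i t i) + #|T| * m)%N.
Proof.
move=> hw ht.
pose s := flatten [seq nseq (t i) i | i <- enum Ix].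
have sumE (F : Ix -> nat) : (\sum_(i <- s) F i = \sum_i t i * F i)%N.
  rewrite /s big_flatten /= big_map big_enum /=; apply: eq_bigr => i _.
  by rewrite big_nseq iter_addn_0 mulnC.
have : exists2 U, colored_off w U (\sum_(i <- s) 1)%N &
    forall a, (#|cell U a| <= maxn m (#|cell [set: V] a| - \sum_(i <- s) l i a))%N.
  elim: s {sumE} => [|i s [U cU hU]].
    exists [set: V]; last by move=> a; rewrite big_nil subn0 leq_maxr.
    by exists (fun=> 0%N); split => [v|x y]; rewrite inE.
  have [U' cU' hU'] := greedy_step i hw cU; exists U'.
    by rewrite big_cons add1n.
  move=> a; apply: (leq_trans (hU' a)); rewrite big_cons.
  by have := hU a; lia.
move=> [U cU hU]; apply: (leq_trans (chi_colored_off cU)).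
apply: leq_add.
  by rewrite sumE; apply: leq_sum => i _; rewrite muln1.
have -> : #|U| = (\sum_a #|cell U a|)%N.
  rewrite -sum1_card (partition_big th predT) //=; apply: eq_bigr => a _.
  by rewrite -sum1_card; apply: eq_bigl => v; rewrite inE.
rewrite -sum_nat_const; apply: leq_sum => a _; apply: (leq_trans (hU a)).
rewrite geq_max leqnn /= (sumE (fun i => l i a)).
by have := ht a; rewrite -subn_eq0 => /eqP ->.
Qed.

End Greedy.

(** * Asymptotics *)

(** The quartic term of the exponential series already wins. *)
Lemma expR_dominates_cube (R : realType) (C c : R) : 0 < c ->
  \forall L \near +oo, C * L ^+ 3 <= expR (c * L).
Proof.
move=> c0; near=> L.
have L0 : 0 <= L by near: L; apply: nbhs_pinfty_ge; exact: num_real.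
have LC : C * 24 / c ^+ 4 <= L by near: L; apply: nbhs_pinfty_ge; exact: num_real.
have := @expR_ge1Dxn R (c * L) 3 (mulr_ge0 (ltW c0) L0).
apply: le_trans; apply: (@le_trans _ _ ((c * L) ^+ 4 / 24)); last by rewrite lerDr.
rewrite ler_pdivlMr // [leLHS](_ : _ = (C * 24) * L ^+ 3); last by ring.
move: LC; rewrite ler_pdivrMr ?exprn_gt0 // => LC.
apply: le_trans (ler_wpM2r (exprn_ge0 3 L0) LC) _.
by rewrite le_eqVlt; apply/orP; left; apply/eqP; ring.
Unshelve. all: by end_near. Qed.

(** * Union bound over profiles, sets of available types and labellings *)

Section UnionBound.
Import mathcomp.boot.fintype mathcomp.boot.finset.
Variables (R : realType) (T Ix : finType) (n : nat) (th : 'I_n -> T).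
Variables (l : Ix -> T -> nat) (La u : nat) (p : 'I_n * 'I_n -> R) (e0 : R).
Hypothesis hp : is_proba p.
Hypothesis he0 : 0 <= e0.
Hypothesis hE : forall i (S : {set T}) (lab : {ffun 'I_n -> option (slot (l i) La S)}),
  (1 < #|{: slot (l i) La S}|)%N -> admissible th u lab ->
  Ex p (fun w => (good lab w == set0)%:R) <= e0.

Lemma union_bound (bad : {ffun 'I_n * 'I_n -> bool} -> bool) :
  (forall w, has_all_transversals th l La u w -> ~~ bad w) ->
  Ex p (fun w => (bad w)%:R) <=
    #|Ix|%:R * 2 ^+ #|T| * expR (n%:R * (#|T| * La)%:R) * e0.
Proof.
move=> hb.
pose F w i S (lab : {ffun 'I_n -> option (slot (l i) La S)}) : bool :=
  [&& (1 < #|{: slot (l i) La S}|)%N, admissible th u lab & good lab w == set0].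
have h1 w : (bad w)%:R <= \sum_i \sum_(S : {set T}) \sum_lab (F w i S lab)%:R :> R.
  case: (boolP (bad w)) => bw; last first.
    by apply: sumr_ge0 => i _; apply: sumr_ge0 => S _; apply: sumr_ge0.
  have [[i [S [lab h]]]|h] := pselect (exists i S lab, F w i S lab).
    rewrite (bigD1 i) //= (bigD1 S) //= (bigD1 lab) //= h -!addrA lerDl.
    by repeat (apply: addr_ge0 || (apply: sumr_ge0 => ? _)).
  exfalso; move/negP: bw; apply.
  suff /hb /negP : has_all_transversals th l La u w by [].
  move=> i S lab h2 h3; apply/negP => h4; apply: h; exists i, S, lab.
  by rewrite /F h2 h3.
apply: le_trans (ler_Ex hp h1) _; rewrite Ex_sum.
have h2 i : Ex p (fun w => \sum_(S : {set T}) \sum_lab (F w i S lab)%:R) <=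
    2 ^+ #|T| * expR (n%:R * (#|T| * La)%:R) * e0.
  rewrite Ex_sum; have -> : 2 ^+ #|T| = #|[set: {set T}]|%:R :> R.
    by rewrite -powersetT card_powerset cardsT natrX.
  rewrite -!mulrA mulr_natl -sumr_const.
  rewrite [leRHS](eq_bigl predT); last by move=> S; rewrite inE.
  apply: ler_sum => S _; rewrite Ex_sum.
  have h3 lab : Ex p (fun w => (F w i S lab)%:R) <= e0.
    case: (boolP ((1 < #|{: slot (l i) La S}|)%N && admissible th u lab)) => [/andP[a1 a2]|h].
      apply: le_trans (hE a1 a2); apply: ler_Ex => // w; rewrite ler_nat /F a1 a2 //.
    apply: le_trans he0; rewrite -(Ex_cst p 0); apply: ler_Ex => // w.
    by rewrite /F andbA (negbTE h).
  apply: (@le_trans _ _ (\sum_(lab : {ffun 'I_n -> option (slot (l i) La S)}) e0)).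
    exact: ler_sum.
  (* Each vertex gets a slot or [None], so there are at most [(1 + #|T| La)^n <= exp(n #|T| La)]
     labellings. *)
  rewrite sumr_const -[leLHS]mulr_natl; apply: ler_wpM2r => //; rewrite card_ffun card_ord card_option natrX.
  rewrite expRM_natl lerXn2r ?nnegrE ?expR_ge0 //.
  rewrite -natr1 addrC; apply: le_trans (expR_ge1Dx _).
  by rewrite lerD2l ler_nat card_slot_le.
apply: le_trans (ler_sum _ (fun i _ => h2 i)) _.
by rewrite sumr_const -[leLHS]mulr_natl !mulrA.
Qed.

End UnionBound.

(** * Choice of the parameters for large n *)

Section Asymptotics.
Import mathcomp.boot.fintype mathcomp.boot.finset.
Variables (R : realType) (T Ix : finType) (k : T -> T -> R).
Variables (K c eta eps del : R) (al B : Ix -> R) (m : Ix -> T -> R).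
Hypothesis k_bnd : forall a b, 0 <= k a b <= K.
Hypothesis ksym : forall a b, k a b = k b a.
Hypothesis c_bnd : 0 < c <= 8^-1.
Hypothesis eta0 : 0 < eta.
Hypothesis eps0 : 0 < eps.
Hypothesis del0 : 0 < del.
Hypothesis al0 : forall i, 0 <= al i.
Hypothesis B0 : forall i, 0 < B i.
Hypothesis m0 : forall i a, 0 < m i a.
Hypothesis vertex : forall i (S : {set T}),
  \sum_(a in S) \sum_(b in S) m i a * m i b * k a b <= B i * \sum_(a in S) m i a.

(** Here [L] is log n. The slack [eta] in the cell sizes pays for rounding the numbers of slots
    down. *)
Lemma chi_tail_near : \forall L \near +oo,
  forall n (th : 'I_n -> T) (p : 'I_n * 'I_n -> R), expR L = n%:R ->
    (forall a, #|[set v | th v == a]|%:R <= \sum_i al i * (m i a - eta) * n%:R) ->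
    is_proba p -> (forall e, p e <= bprob th k e) ->
    Ex p (fun w => ((\sum_i al i * B i / (1 - c) + eps) * (n%:R / (2 * L)) <
      (chi (graph_of w))%:R)%R%:R) <= del.
Proof.
case/andP: (c_bnd) => c0 c8.
have c1 : 0 < 1 - c by lra.
pose C1 := \sum_i \sum_a m i a * 2 / B i.
pose C2 := #|T|%:R * C1.
pose C3 := \sum_i \sum_a 2 * B i / m i a.
pose C4 := #|Ix|%:R + C2 + C2 ^+ 2.
pose C5 := #|Ix|%:R * 2 ^+ #|T| / del.
have C10 : 0 <= C1.
  by apply: sumr_ge0 => i _; apply: sumr_ge0 => a _; rewrite divr_ge0 ?mulr_ge0 // ltW.
have C20 : 0 <= C2 by rewrite mulr_ge0.
have C1_ge i a : m i a * 2 / B i <= C1.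
  rewrite /C1 (bigD1 i) //= (bigD1 a) //= -addrA lerDl addr_ge0 //.
    by apply: sumr_ge0 => b _; rewrite divr_ge0 ?mulr_ge0 // ltW.
  by apply: sumr_ge0 => j _; apply: sumr_ge0 => b _; rewrite divr_ge0 ?mulr_ge0 // ltW.
have C3_ge i a : 2 * B i / m i a <= C3.
  rewrite /C3 (bigD1 i) //= (bigD1 a) //= -addrA lerDl addr_ge0 //.
    by apply: sumr_ge0 => b _; rewrite divr_ge0 ?mulr_ge0 // ltW.
  by apply: sumr_ge0 => j _; apply: sumr_ge0 => b _; rewrite divr_ge0 ?mulr_ge0 // ltW.
pose C6 := \sum_i B i / eta.
have C6_ge i : B i / eta <= C6.
  rewrite /C6 (bigD1 i) //= lerDl; apply: sumr_ge0 => j _.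
  by rewrite divr_ge0 // ltW.
near=> L => n th p eL hth hp pb.
have L1 : 1 <= L by near: L; apply: nbhs_pinfty_ge; exact: num_real.
have LK : 16 + 64 * K / c ^+ 2 <= L by near: L; apply: nbhs_pinfty_ge; exact: num_real.
have L3 : C3 <= L by near: L; apply: nbhs_pinfty_ge; exact: num_real.
have L6 : C6 <= L by near: L; apply: nbhs_pinfty_ge; exact: num_real.
have L5 : C5 <= L by near: L; apply: nbhs_pinfty_ge; exact: num_real.
(* A cube because the leftover, of order [L^2 n^(1 - c/2)], must be small against [n / L]. *)
have Le : 2 * C4 / eps * L ^+ 3 <= expR (c / 2 * L).
  by near: L; apply: expR_dominates_cube; rewrite divr_gt0.
(* Keeps the entropy [C2 L n] of the labellings below [n^(3/2) / 4], with [L n] to spare. *)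
have Lh : (4 * (C2 + 1)) * L ^+ 3 <= expR (2^-1 * L).
  by near: L; apply: expR_dominates_cube; rewrite invr_gt0.
have L0 : 0 < L by lra.
have L2 : 1 <= L ^+ 2 by rewrite exprn_ege1.
have L32 : L <= L ^+ 3 by rewrite exprS ler_peMr // ltW.
have n0 : 0 < n%:R :> R by rewrite -eL expR_gt0.
(* The scale for which the bound [A B / 2] of [kap_slot_le] is [(1 - c) L] per slot. *)
pose A i := 2 * (1 - c) * L / B i.
have A0 i : 0 < A i by rewrite /A divr_gt0 // !mulr_gt0.
pose l i a := Num.truncn (m i a * A i).
have mA0 i a : 0 <= m i a * A i by rewrite mulr_ge0 // ltW.
have l_leA i a : (l i a)%:R <= m i a * A i by rewrite truncn_le mA0.
have l_gtA i a : m i a * A i - 1 <= (l i a)%:R.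
  by rewrite lerBlDr natr1 ltW // truncnS_gt.
pose La := Num.truncn (C1 * L).
have La_le : La%:R <= C1 * L by rewrite truncn_le mulr_ge0 // ltW.
have mAC i a : m i a * A i <= C1 * L.
  apply: le_trans (ler_wpM2r (ltW L0) (C1_ge i a)).
  rewrite /A [leRHS](_ : _ = m i a * L * 2 / B i); last by ring.
  rewrite [leLHS](_ : _ = (m i a * L * 2 / B i) * (1 - c)); last by ring.
  rewrite ler_piMr //; last by lra.
  by rewrite divr_ge0 ?mulr_ge0 // ltW.
have l_La i a : (l i a <= La)%N by rewrite /l /La le_truncn.
pose D := expR ((1 - c / 2) * L).
have c2 : 0 <= 1 - c / 2 by lra.
have D1 : 1 <= D by rewrite -[leLHS]expR0 /D ler_expR mulr_ge0 ?(ltW L0).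
(* At least [n^(1 - c/2)] times the number of slots, which is at most [#|T| La <= C2 L]. *)
pose u := (Num.truncn (C2 * L * D)).+1.
have u_ge : C2 * L * D <= u%:R by rewrite ltW // truncnS_gt.
have u_le : u%:R <= C2 * L * D + 1.
  by rewrite -natr1 lerD2r truncn_le // !mulr_ge0 // ltW // expR_gt0.
have H_le : (#|T| * La)%:R <= C2 * L.
  by rewrite natrM /C2 -mulrA ler_wpM2l.
(* [L >= C3] gives [m i a * A i >= 2]. *)
have l_ge2 i a : (1 < l i a)%N.
  rewrite /l truncn_ge_nat //.
  have := le_trans (C3_ge i a) L3; rewrite ler_pdivrMr // => h.
  rewrite /A mulrA ler_pdivlMr //; apply: (le_trans h).
  rewrite [leRHS](_ : _ = L * m i a * (2 * (1 - c))); last by ring.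
  by rewrite ler_peMr ?mulr_ge0 ?(ltW L0) ?(ltW (m0 i a)) //; lra.
pose t i := (Num.truncn (al i * n%:R / A i)).+1.
have anA0 i : 0 <= al i * n%:R / A i.
  by apply: divr_ge0; [apply: mulr_ge0; [exact: al0|exact: ltW]|exact: ltW].
have t_ge i : al i * n%:R / A i <= (t i)%:R by rewrite ltW // truncnS_gt.
have t_le i : (t i)%:R <= al i * n%:R / A i + 1 by rewrite -natr1 lerD2r truncn_le anA0.
(* [L >= C6] gives [eta * A i >= 1], which covers the truncation. *)
have l_eta i a : (m i a - eta) * A i <= (l i a)%:R.
  apply: le_trans (l_gtA i a); rewrite mulrBl lerB //.
  have := le_trans (C6_ge i) L6; rewrite ler_pdivrMr // => h.
  rewrite /A mulrA ler_pdivlMr // mul1r; apply: (le_trans h).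
  rewrite [leRHS](_ : _ = L * eta * (2 * (1 - c))); last by ring.
  by rewrite ler_peMr ?mulr_ge0 ?(ltW L0) ?(ltW eta0) //; lra.
pose mm := (La * u)%N.
have l_mm i a : (l i a * u <= mm)%N by rewrite leq_mul2r l_La orbT.
have cells a : (#|cell th [set: 'I_n] a| <= \sum_i t i * l i a)%N.
  rewrite -(ler_nat R) natr_sum.
  have -> : cell th [set: 'I_n] a = [set v | th v == a].
    by apply/setP => v; rewrite !inE.
  apply: (le_trans (hth a)); apply: ler_sum => i _; rewrite natrM.
  apply: (@le_trans _ _ (al i * n%:R / A i * (l i a)%:R)); last by rewrite ler_wpM2r.
  apply: le_trans (ler_wpM2l (anA0 i) (l_eta i a)).
  by rewrite le_eqVlt; apply/orP; left; apply/eqP; field; rewrite lt0r_neq0.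
have T_mm : (#|T| * mm)%:R <= C2 * L * (C2 * L * D + 1).
  by rewrite /mm mulnA natrM ler_pM.
have sum_t : (\sum_i t i)%:R <= \sum_i al i * B i / (1 - c) * (n%:R / (2 * L)) + #|Ix|%:R.
  rewrite natr_sum -[#|Ix|%:R]sumr_const -big_split /=; apply: ler_sum => i _.
  apply: (le_trans (t_le i)); rewrite lerD2r le_eqVlt; apply/orP; left; apply/eqP.
  by rewrite /A; field; rewrite !lt0r_neq0.
have err : #|Ix|%:R + C2 * L * (C2 * L * D + 1) <= eps * (n%:R / (2 * L)).
  apply: (@le_trans _ _ (C4 * (L ^+ 2 * D))).
    have LD1 : 1 <= L ^+ 2 * D by rewrite mulr_ege1.
    have LD2 : L <= L ^+ 2 * D.
      by apply: (@le_trans _ _ (L ^+ 2)); rewrite ?ler_peMr ?expr2 ?ler_peMr ?sqr_ge0 // ltW.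
    have I0 : 0 <= #|Ix|%:R :> R by [].
    have e1 := ler_wpM2l I0 LD1; have e2 := ler_wpM2l C20 LD2.
    rewrite /C4 [C2 * L * _](_ : _ = C2 ^+ 2 * (L ^+ 2 * D) + C2 * L); last by ring.
    by lra.
  rewrite [leRHS]mulrA ler_pdivlMr ?mulr_gt0 //.
  have Dn : n%:R = D * expR (c / 2 * L) by rewrite -eL /D -expRD; congr expR; ring.
  rewrite Dn [leRHS](_ : _ = (eps * D) * expR (c / 2 * L)); last by ring.
  have eD0 : 0 < eps * D by rewrite mulr_gt0 // expR_gt0.
  apply: le_trans (ler_wpM2l (ltW eD0) Le).
  by rewrite le_eqVlt; apply/orP; left; apply/eqP; field; rewrite lt0r_neq0.
have bnd w : has_all_transversals th l La u w ->
    ~~ ((\sum_i al i * B i / (1 - c) + eps) * (n%:R / (2 * L)) < (chi (graph_of w))%:R).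
  move=> hw; rewrite -leNgt.
  have := @greedy_chi n T th Ix l La mm u (ltn0Sn _) l_La l_ge2 l_mm w t hw cells.
  rewrite -(ler_nat R) natrD => h; apply: (le_trans h).
  apply: le_trans (lerD sum_t T_mm) _.
  by rewrite [leRHS]mulrDl -[leLHS]addrA mulr_suml lerD2l.
pose e0 := expR (- (expR (3 / 2 * L) / 4)).
apply: le_trans (@union_bound R T Ix n th l La u p e0 hp (expR_ge0 _) _ _ bnd) _.
  move=> i S lab J2 /andP[/forallP lab1 /forallP lab2].
  have th_lab v j : lab v = Some j -> th v = slot_type j.
    by move=> e; have /forallP /(_ j) := lab1 v; rewrite e eqxx => /eqP.
  have u0 : 0 < u%:R :> R by rewrite ltr0n.
  apply: (@prob_no_transversal R T _ (@slot_type _ _ _ _) k K c L u%:R) => //.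
  - apply: (@le_trans _ _ (C2 * L)).
      by apply: le_trans H_le; rewrite ler_nat card_slot_le.
    apply: le_trans (ler_wpM2r (expR_ge0 _) u_ge).
    rewrite -[leRHS]mulrA /D -expRD mulNr subrr expR0 mulr1 //.
  - move=> I; have k0 a b : 0 <= k a b by case/andP: (k_bnd a b).
    have := @kap_slot_le R T k k0 (l i) La S (m i) (B i) (A i) I (A0 i) (vertex i) (l_leA i).
    move=> h; apply: (le_trans h); rewrite le_eqVlt; apply/orP; left; apply/eqP.
    by rewrite /A; field; rewrite lt0r_neq0.
  - exact: th_lab.
  - by move=> j; rewrite ler_nat; exact: lab2.
have e1 : expR (n%:R * (#|T| * La)%:R) * e0 <= expR (- L).
  rewrite /e0 -expRD ler_expR.
  have h1 : n%:R * (#|T| * La)%:R <= expR L * (C2 * L) by rewrite eL ler_wpM2l // ltW.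
  have h2 : expR L * ((C2 + 1) * L) <= expR (3 / 2 * L) / 4.
    rewrite [3 / 2 * L](_ : _ = L + 2^-1 * L); last by field.
    rewrite expRD -mulrA ler_wpM2l ?expR_ge0 // ler_pdivlMr //.
    apply: le_trans Lh; rewrite [leLHS](_ : _ = 4 * (C2 + 1) * L); last by ring.
    by rewrite ler_wpM2l //; lra.
  have h3 : L <= expR L * L by rewrite ler_peMl ?ltW // -expR0 ltr_expR.
  have h4 : expR L * ((C2 + 1) * L) = expR L * (C2 * L) + expR L * L by ring.
  by lra.
rewrite -mulrA; apply: le_trans (ler_wpM2l _ e1) _; first by rewrite mulr_ge0 // exprn_ge0.
rewrite expRN ler_pdivrMr ?expR_gt0 // [leRHS]mulrC -ler_pdivrMr //.
by apply: (le_trans L5); apply: le_trans (expR_ge1Dx _); rewrite lerDr.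
Unshelve. all: by end_near. Qed.

End Asymptotics.

(** * Tail bound for the chromatic number in terms of the original masses *)

Section ChiTail.
Import mathcomp.boot.fintype mathcomp.boot.finset.
Variables (R : realType) (T Ix : finType) (k : T -> T -> R).
Variables (K eps : R) (al Ph : Ix -> R) (mu : Ix -> T -> R).
Hypothesis k_bnd : forall a b, 0 <= k a b <= K.
Hypothesis ksym : forall a b, k a b = k b a.
Hypothesis eps0 : 0 < eps.
Hypothesis al0 : forall i, 0 <= al i.
Hypothesis al1 : \sum_i al i = 1.
Hypothesis Ph0 : forall i, 0 <= Ph i.
Hypothesis mu0 : forall i a, 0 <= mu i a.
Hypothesis vertex : forall i (S : {set T}),
  \sum_(a in S) \sum_(b in S) mu i a * mu i b * k a b <= Ph i * \sum_(a in S) mu i a.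

(* Adding h to every mass makes all types available and absorbs roundings. *)
Lemma vertex_shift (i : Ix) (S : {set T}) (h : R) : 0 <= h ->
  \sum_(a in S) \sum_(b in S) (mu i a + h) * (mu i b + h) * k a b <=
  (Ph i + 2 * h * K * #|T|%:R) * \sum_(a in S) (mu i a + h).
Proof.
move=> h0; set s := \sum_(a in S) mu i a.
have s0 : 0 <= s by apply: sumr_ge0.
have kK a b : k a b <= K by case/andP: (k_bnd a b).
have k0 a b : 0 <= k a b by case/andP: (k_bnd a b).
have e1 : \sum_(a in S) \sum_(b in S) (mu i a + h) * (mu i b + h) * k a b <=
  \sum_(a in S) \sum_(b in S) mu i a * mu i b * k a b +
  \sum_(a in S) \sum_(b in S) h * K * (mu i a + mu i b + h).
  rewrite -big_split /=; apply: ler_sum => a _; rewrite -big_split /=.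
  apply: ler_sum => b _.
  have -> : (mu i a + h) * (mu i b + h) * k a b = mu i a * mu i b * k a b +
     k a b * (h * (mu i a + mu i b + h)) by ring.
  rewrite lerD2l [leRHS](_ : _ = K * (h * (mu i a + mu i b + h))); last by ring.
  by rewrite ler_wpM2r // mulr_ge0 // !addr_ge0.
have N : \sum_(a in S) (mu i a + h) = s + h * #|S|%:R.
  by rewrite big_split /= sumr_const mulr_natr.
have e2 : \sum_(a in S) \sum_(b in S) h * K * (mu i a + mu i b + h) =
   h * K * (2 * s + h * #|S|%:R) * #|S|%:R.
  rewrite (eq_bigr (fun a => h * K * (mu i a * #|S|%:R + s + h * #|S|%:R))); last first.
    move=> a _; rewrite -mulr_sumr !big_split /= !sumr_const -/s.
    by rewrite -[mu i a *+ _]mulr_natr -[h *+ _]mulr_natr.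
  rewrite -mulr_sumr !big_split /= -mulr_suml -/s !sumr_const.
  by rewrite -[s *+ _]mulr_natr -[(h * _) *+ _]mulr_natr; ring.
rewrite N; apply: (le_trans e1); rewrite e2.
apply: (le_trans (lerD (vertex i S) (lexx _))); rewrite -/s.
have ST : #|S|%:R <= #|T|%:R :> R by rewrite ler_nat max_card.
have [T0|[a _]] := set_0Vmem S.
  by rewrite T0 cards0 /s T0 big_set0 !mulr0 !addr0 mulr0.
have K0 : 0 <= K by apply: le_trans (k0 a a) (kK a a).
have S0 : 0 <= #|S|%:R :> R by [].
have hS : 0 <= h * #|S|%:R by rewrite mulr_ge0.
have e3 : h * K * (2 * s + h * #|S|%:R) * #|S|%:R <=
  h * K * (2 * (s + h * #|S|%:R)) * #|T|%:R.
  apply: ler_pM => //; first by rewrite !mulr_ge0 // addr_ge0 // mulr_ge0.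
  by rewrite ler_wpM2l ?mulr_ge0 //; lra.
have e4 := mulr_ge0 (Ph0 i) hS.
have -> : (Ph i + 2 * h * K * #|T|%:R) * (s + h * #|S|%:R) = Ph i * s +
  Ph i * (h * #|S|%:R) + h * K * (2 * (s + h * #|S|%:R)) * #|T|%:R by ring.
by lra.
Qed.

(** [eta] is fixed before [del] because it is also the accuracy demanded of the type counts;
    [eta <= 1] suits the Chernoff bound for these counts. *)
Lemma chi_tail : exists2 eta, 0 < eta <= 1 & forall del, 0 < del ->
  \forall n \near \oo%classic,
  forall (th : 'I_n -> T) (p : 'I_n * 'I_n -> R),
    (forall a, #|[set v | th v == a]|%:R <= (\sum_i al i * mu i a + eta) * n%:R) ->
    is_proba p -> (forall e, p e <= bprob th k e) ->
    Ex p (fun w => ((\sum_i al i * Ph i + eps) * (n%:R / (2 * ln n%:R)) <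
      (chi (graph_of w))%:R)%R%:R) <= del.
Proof.
have he : 0 < eps := eps0.
pose Q := \sum_i al i * Ph i.
have Q0 : 0 <= Q by apply: sumr_ge0 => i _; rewrite mulr_ge0.
(* The absolute value covers an empty [T], where the sign of [K] is unknown; the 1 keeps [B i]
   positive when [Ph i = 0]. *)
pose Z := 4 * `|K| * #|T|%:R + 1.
have Z1 : 1 <= Z by rewrite /Z lerDr !mulr_ge0.
pose eta := Num.min 1 (eps / (8 * Z)).
have Z0 : 0 < Z by lra.
have eta0 : 0 < eta by rewrite /eta lt_min ltr01 divr_gt0 // mulr_gt0.
have eta1 : eta <= 1 by rewrite /eta ge_min lexx.
have etaZ : eta * Z <= eps / 8.
  have : eta <= eps / (8 * Z) by rewrite /eta ge_min lexx orbT.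
  rewrite -(ler_pM2r (_ : 0 < Z)) ?(lt_le_trans ltr01 Z1) //.
  move=> /le_trans; apply; rewrite le_eqVlt; apply/orP; left; apply/eqP.
  by field; apply: lt0r_neq0; lra.
(* Chosen so that the shift [eta * Z] and the division by [1 - c] together cost at most
   [eps / 2]. *)
pose c := Num.min 8^-1 (eps / (8 * (Q + eps + 1))).
have Qe0 : 0 < Q + eps + 1 by lra.
have c0 : 0 < c by rewrite /c lt_min invr_gt0 divr_gt0 ?mulr_gt0 // ltr0n.
have c8 : c <= 8^-1 by rewrite /c ge_min lexx.
have cQ : c * (Q + eps) <= eps / 8.
  have : c <= eps / (8 * (Q + eps + 1)) by rewrite /c ge_min lexx orbT.
  rewrite -(ler_pM2r (_ : 0 < Q + eps + 1)); last by lra.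
  have -> : eps / (8 * (Q + eps + 1)) * (Q + eps + 1) = eps / 8.
    by field; apply: lt0r_neq0; lra.
  by nra.
have c1 : 0 < 1 - c by lra.
pose B i := Ph i + eta * Z.
(* One [eta] covers the deviation of the type counts, the other the rounding in [chi_tail_near]. *)
pose m i a := mu i a + 2 * eta.
have B0 i : 0 < B i.
  by rewrite /B ltr_wpDl // mulr_gt0 //; lra.
have m0 i a : 0 < m i a by rewrite /m ltr_wpDl // mulr_gt0.
have vB i (S : {set T}) : \sum_(a in S) \sum_(b in S) m i a * m i b * k a b <= B i * \sum_(a in S) m i a.
  apply: (le_trans (vertex_shift i S (_ : 0 <= 2 * eta))); first by lra.
  apply: ler_wpM2r; first by apply: sumr_ge0 => a _; exact: ltW (m0 i a).
  rewrite /B lerD2l /Z mulrDr.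
  have h1 : K * #|T|%:R <= `|K| * #|T|%:R by rewrite ler_wpM2r // ler_norm.
  have : eta * (K * #|T|%:R) <= eta * (`|K| * #|T|%:R) by rewrite ler_wpM2l // ltW.
  by lra.
have sumB : \sum_i al i * B i / (1 - c) + eps / 2 <= Q + eps.
  have -> : \sum_i al i * B i / (1 - c) = (Q + eta * Z) / (1 - c).
    rewrite -mulr_suml; congr (_ / _); rewrite /B /Q.
    rewrite -[eta * Z in RHS]mul1r -al1 mulr_suml -big_split /=.
    by apply: eq_bigr => i _; rewrite mulrDr.
  rewrite -lerBrDr ler_pdivrMr //; nra.
exists eta; first by rewrite eta0.
move=> del del0.
have e2 : 0 < eps / 2 by lra.
have c01 : 0 < c <= 8^-1 by rewrite c0.
have [M [_ hM]] := chi_tail_near k_bnd ksym c01 eta0 e2 del0 al0 B0 m0 vB.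
near=> n => th p hth hp pb.
have nM : expR M < n%:R by near: n; exact: nbhs_infty_gtr.
have n1 : 1 < n%:R :> R by near: n; exact: nbhs_infty_gtr.
have n0 : 0 < n%:R :> R by lra.
have lnM : M < ln n%:R by rewrite -(expRK M) ltr_ln // posrE ?expR_gt0.
have ln0 : 0 < ln n%:R :> R by rewrite ln_gt0.
apply: le_trans (hM _ lnM n th p _ _ hp pb) .
- apply: ler_Ex => // w; rewrite ler_nat; case: ltP => //= h.
  suff -> : (\sum_i al i * B i / (1 - c) + eps / 2) * (n%:R / (2 * ln n%:R)) < (chi (graph_of w))%:R by [].
  apply: le_lt_trans h; rewrite ler_wpM2r // divr_ge0 ?ltW //.
  by rewrite mulr_gt0.
- by rewrite lnK.
- move=> a; apply: (le_trans (hth a)); rewrite -mulr_suml ler_wpM2r ?(ltW n0) //.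
  rewrite -[eta in leLHS]mul1r -al1 mulr_suml -big_split /=.
  by apply: ler_sum => i _; rewrite /m; rewrite -mulrDr ler_wpM2l //; lra.
Unshelve. all: by end_near. Qed.

End ChiTail.

(** * Concentration of the number of vertices of a type *)

Section Chernoff.
Variables (R : realType) (T : finType) (n : nat) (la : T -> R).
Hypothesis la0 : forall a, 0 <= la a.
Hypothesis la1 : \sum_a la a = 1.

(** Exponential Markov inequality with [t = eta / 2], the minimiser of [t^2 - t eta]. Type vectors
    carry their probability as a weight, so only finite sums occur. *)
Lemma chernoff (a : T) (eta : R) : 0 < eta <= 1 ->
  \sum_(th : {ffun 'I_n -> T} | (la a + eta) * n%:R < (#|[pred v | th v == a]|)%:R)
     \prod_i la (th i) <= expR (- (eta ^+ 2 / 4 * n%:R)).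
Proof.
move=> /andP[eta0 eta1]; pose t := eta / 2.
have t0 : 0 < t by rewrite /t; lra.
pose F b := la b * expR (t * (b == a)%:R).
have F0 b : 0 <= F b by rewrite mulr_ge0 ?expR_ge0.
have FE (th : {ffun 'I_n -> T}) : \prod_i F (th i) =
    \prod_i la (th i) * expR (t * #|[pred v | th v == a]|%:R).
  rewrite big_split /= -expR_sum -mulr_sumr; congr (_ * expR (_ * _)).
  rewrite -sum1_card natr_sum [RHS]big_mkcond /=; apply: eq_bigr => i _.
  by rewrite inE; case: eqP.
apply: (@le_trans _ _ (expR (- (t * ((la a + eta) * n%:R))) *
    \sum_(th : {ffun 'I_n -> T}) \prod_i F (th i))).
  rewrite mulr_sumr big_mkcond /=; apply: ler_sum => th _; case: ifP => h; last first.
    by rewrite mulr_ge0 ?expR_ge0 // prodr_ge0.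
  rewrite FE mulrCA ler_peMr ?prodr_ge0 // -expRD -[leLHS]expR0 ler_expR.
  by rewrite addrC subr_ge0 ler_wpM2l // ltW.
rewrite -(bigA_distr_bigA (fun _ b => F b)) prodr_const card_ord.
have sF : \sum_b F b <= expR (la a * t + t ^+ 2).
  have la_le1 : la a <= 1.
    by rewrite -la1 (bigD1 a) //= lerDl sumr_ge0.
  have -> : \sum_b F b = 1 + la a * (expR t - 1).
    have s1 : \sum_(b | b != a) la b = 1 - la a.
      by rewrite -la1 [X in X - _](bigD1 a) //= addrAC subrr add0r.
    rewrite (bigD1 a) //= (eq_bigr la); last first.
      by move=> b /negbTE; rewrite /F => ->; rewrite mulr0 expR0 mulr1.
    by rewrite s1 /F eqxx mulr1; ring.
  apply: le_trans (expR_ge1Dx _); rewrite lerD2l.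
  have : expR t <= 1 + t + t ^+ 2.
    by apply: expR_le1Dxx2; rewrite ger0_norm ?(ltW t0) // /t; lra.
  have := sqr_ge0 t; have := la0 a; nra.
have sF0 : 0 <= \sum_b F b by apply: sumr_ge0.
apply: (@le_trans _ _ (expR (- (t * ((la a + eta) * n%:R))) * expR (la a * t + t ^+ 2) ^+ n)).
  by rewrite ler_wpM2l ?expR_ge0 // lerXn2r ?nnegrE ?expR_ge0.
rewrite -expRM_natr -expRD ler_expR le_eqVlt; apply/orP; left; apply/eqP.
by rewrite /t; field.
Qed.

End Chernoff.

Local Open Scope classical_set_scope.
Local Open Scope ring_scope.

(** * Transfer from the conditional law to finite sums *)

Lemma measure_fiber_sum (R : realType) (d : measure_display)
    (Om : measurableType d) (mu : {measure set Om -> \bar R}) (K : finType)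
    (f : Om -> K) (E : set Om) :
  (forall x, measurable [set w | f w = x]) -> measurable E ->
  mu E = (\sum_(x : K) mu (E `&` [set w | f w = x]))%E.
Proof.
move=> mf mE.
have -> : E = \bigcup_(x in [set: K]) (E `&` [set w | f w = x]).
  by apply/seteqP; split => [w Ew|w [x _ []//]]; exists (f w).
have fK : finite_set [set: K] by exact: finite_finset.
rewrite measure_fin_bigcup //.
- rewrite fsbig_finite //=; rewrite (perm_big (index_enum K)) /=.
    apply: eq_bigr => x _; congr (mu _); apply/seteqP; split => w.
      by move=> [Ew fw]; split => //; exists x.
    by move=> [[y _ [Ew _]] fw].
  apply: uniq_perm; rewrite ?index_enum_uniq ?finmap.fset_uniq //.
  by move=> x; rewrite mem_index_enum in_fset_set ?mem_set //; exact: finite_finset.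
- by move=> x y _ _ [w [[_ <-] [_ <-]]].
- by move=> x _; exact: measurableI.
Qed.

Lemma measurable_forall_fin (d : measure_display) (Om : measurableType d)
    (K : finType) (Q : K -> Om -> Prop) :
  (forall x, measurable [set w | Q x w]) -> measurable [set w | forall x, Q x w].
Proof.
move=> mQ; have -> : [set w | forall x, Q x w] = \bigcap_(x in [set: K]) [set w | Q x w].
  by apply/seteqP; split => [w h x _|w h x]; [exact: h|apply: h].
by apply: fin_bigcap_measurable => //; exact: finite_finset.
Qed.

Lemma measurable_finType_pred (d : measure_display) (Om : measurableType d)
    (K : finType) (f : Om -> K) (Q : K -> Prop) :
  (forall x, measurable [set w | f w = x]) -> measurable [set w | Q (f w)].
Proof.
move=> mf; have -> : [set w | Q (f w)] = \bigcup_(x in [set x | Q x]) [set w | f w = x].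
  apply/seteqP; split => w /=; first by move=> h; exists (f w).
  by move=> [x Qx fx]; rewrite fx.
by apply: fin_bigcup_measurable => //; exact: finite_finset.
Qed.

Lemma chi_ext (V : finType) (G H : sgraph V) : adj G =2 adj H -> chi G = chi H.
Proof.
move=> GH; have col : colorable G =1 colorable H.
  move=> t; apply: eq_existsb => c; apply: eq_forallb => x; apply: eq_forallb => y.
  by rewrite GH.
apply/eqP; rewrite eqn_leq /chi; case: ex_minnP => a ha la.
by case: ex_minnP => b hb lb; rewrite la ?lb // -?col // col.
Qed.

Section Transfer.
Variables (R : realType) (W : R -> R -> R) (n : nat).
Variables (d : measure_display) (Om : measurableType d) (P : probability Om R).
Variable (G : Om -> sgraph 'I_n).
Hypothesis Gnw : is_Gnw W P G.
Hypothesis Wgr : is_graphon W.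
Variables (T : finType) (tau : R -> T) (k : T -> T -> R).
Hypothesis tau_m : forall a, measurable [set x | tau x = a].
Hypothesis W_le : forall x y : R, x \in `[0, 1] -> y \in `[0, 1] ->
  W x y <= 1 - expR (- k (tau x) (tau y)).

(** False on the dummy coordinates, where [bprob] vanishes. *)
Definition code (w : Om) : {ffun 'I_n * 'I_n -> bool} :=
  [ffun e : 'I_n * 'I_n => (e.1 < e.2)%N && adj (G w) e.1 e.2].

Lemma adj_code w : adj (G w) =2 adj (graph_of (code w)).
Proof.
move=> x y; rewrite /= /edge !ffunE /=.
case: (ltngtP x y) => xy /=; [by rewrite orbF|by rewrite adj_sym|].
by rewrite (val_inj xy) adj_irr.
Qed.

Lemma chi_code w : chi (G w) = chi (graph_of (code w)).
Proof. exact/chi_ext/adj_code. Qed.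

Lemma code_m om : measurable [set w | code w = om].
Proof.
have [Gm _] := Gnw.
have -> : [set w | code w = om] = [set w | forall e, code w e = om e].
  by apply/seteqP; split => [w <- //|w h]; exact/ffunP.
apply: measurable_forall_fin => e.
have -> : [set w | code w e = om e] =
    [set w | ((e.1 < e.2)%N && adj (G w) e.1 e.2) = om e].
  by apply/seteqP; split => w /=; rewrite /code ffunE.
case: (e.1 < e.2)%N => /=; case: (om e) => /=.
- exact: Gm.
- have -> : [set w | adj (G w) e.1 e.2 = false] = ~` [set w | adj (G w) e.1 e.2].
    by apply/seteqP; split => w /= /negP; case: adj.
  by apply: measurableC; exact: Gm.
- have -> : [set w : Om | false = true] = set0 by apply/seteqP; split.
  exact: measurable0.
- have -> : [set w : Om | false = false] = setT by apply/seteqP; split.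
  exact: measurableT.
Qed.

Variables (good : pred {ffun 'I_n -> T}) (bad : pred {ffun 'I_n * 'I_n -> bool}).
Variable (del : R).
Hypothesis del0 : 0 <= del.
Hypothesis bad_le : forall th, good th ->
  forall p, is_proba p -> (forall e, p e <= bprob th k e) ->
  Ex p (fun w => (bad w)%:R) <= del.

Let la a : R := fine (uniform_prob (@ltr01 R) [set x | tau x = a]).

(** The event that the types are [th] lies in the sigma-algebra of the X_i. On it the conditional
    law of the graph is product Bernoulli with parameters at most [bprob th k], so [bad_le] applies
    pointwise; type vectors that are not [good] count with their full probability. *)
Lemma transfer :
  (P [set w | bad (code w)] <=
   (\sum_(th | ~~ good th) \prod_i la (th i) + del)%:E)%E.
Proof.
have [Gm [X [X01 Xunif Xind Xcond]]] := Gnw.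
pose C := \big[setU/set0]_(i < n) preimage_set_system setT (X i : Om -> R) measurable.
have CE : g_sigma_preimage (fun i => X i : Om -> R) = <<s C >> by [].
have C_m (A : set Om) : <<s C >> A -> measurable A.
  apply: smallest_sub; first exact: sigma_algebra_measurable.
  rewrite /C => B; elim/big_ind: _ => //.
    by move=> S1 S2 h1 h2 [/h1|/h2].
  move=> i _ [D mD <-]; rewrite setTI.
  by rewrite -[X in measurable X]setTI; exact: measurable_funPT.
pose ty w : {ffun 'I_n -> T} := [ffun i => tau (X i w)].
pose At th := [set w | ty w = th].
have AtE th : At th = \bigcap_(i in [set: 'I_n]) (X i @^-1` [set x | tau x = th i]).
  apply/seteqP; split => w; first by move=> <- i _; rewrite /ty /= ffunE.
  by move=> h; apply/ffunP => i; rewrite ffunE; exact: h.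
have At_C th : <<s C >> (At th).
  rewrite AtE; suff : measurable (\bigcap_(i in [set: 'I_n]) (X i @^-1` [set x | tau x = th i])
     : set (g_sigma_algebraType C)) by [].
  apply: fin_bigcap_measurable; first exact: finite_finset.
  move=> i _; apply: sub_sigma_algebra.
  rewrite /C (bigD1 i) //=; left; exists [set x | tau x = th i] => //.
  by rewrite setTI.
have At_m th : measurable (At th) by apply: C_m.
have At_P th : P (At th) = (\prod_i la (th i))%:E.
  rewrite AtE Xind // -prodEFin; apply: eq_bigr => i _.
  have := Xunif i _ (tau_m (th i)); rewrite /distribution /= /pushforward => ->.
  rewrite /la fineK //.
  apply: (fin_num_measure (uniform_prob (@ltr01 R))); exact: tau_m.
have bad_m : measurable [set w | bad (code w)].
  exact: (@measurable_finType_pred _ _ _ code (fun om => bad om) code_m).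
rewrite (measure_fiber_sum P (f := ty)) // (bigID good) /= addeC EFinD.
have good_le th : good th -> (P ([set w | bad (code w)] `&` At th) <= del%:E * P (At th))%E.
  move=> gth.
  pose pw w (e : 'I_n * 'I_n) : R := if (e.1 < e.2)%N then W (X e.1 w) (X e.2 w) else 0.
  have pw_p w : is_proba (pw w).
    move=> e; rewrite /pw; case: ifP => _; last by rewrite lexx ler01.
    by apply: (graphon_range Wgr); exact: X01.
  have pw_b w : At th w -> forall e, pw w e <= bprob th k e.
    move=> Aw e; rewrite /pw /bprob; case: ifP => // _.
    by rewrite -Aw /ty !ffunE; apply: W_le; exact: X01.
  rewrite (measure_fiber_sum P (f := code)) //; last first.
  - exact: measurableI.
  - exact: code_m.
  pose F0r (om : {ffun 'I_n * 'I_n -> bool}) (w : Om) : R := (bad om)%:R * wt (pw w) om.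
  pose F om := EFin \o F0r om.
  pose valid (om : {ffun 'I_n * 'I_n -> bool}) := [forall e : 'I_n * 'I_n, om e ==> (e.1 < e.2)%N] : bool.
  pose pH (om : {ffun 'I_n * 'I_n -> bool}) w := \prod_(i < n) \prod_(j < n | (i < j)%N)
     (if adj (graph_of om) i j then W (X i w) (X j w) else 1 - W (X i w) (X j w)).
  (* [pw] vanishes on the dummies, so a code with a true dummy has weight 0; any other weight is the
     conditional probability of [is_Gnw]. *)
  have wtE om w : wt (pw w) om = if valid om then pH om w else 0.
    case: ifP => [/forallP vom|/negbT]; last first.
      rewrite negb_forall => /existsP[e]; rewrite negb_imply => /andP[oe ne].
      by rewrite /wt (bigD1 e) //= oe /pw (negbTE ne) mul0r.
    rewrite /wt /pH pair_big_dep /= [RHS]big_mkcond /=; apply: eq_bigr => -[i j] _ /=.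
    have := vom (i, j); rewrite /pw /edge /=; case: (ltngtP i j) => ij /=.
    - by rewrite orbF.
    - by rewrite implybF => /negbTE ->; rewrite subr0.
    - by rewrite implybF => /negbTE ->; rewrite subr0.
  have pH_m om : measurable_fun (At th) (pH om).
    move=> mA B mB; apply: measurableI => //; apply: C_m.
    by have [h _] := Xcond (graph_of om); exact: h.
  have F_m om : measurable_fun (At th) (F om).
    apply/measurable_EFinP; rewrite (_ : F0r om = (fun w =>
      (bad om)%:R * (if valid om then pH om w else 0))); last first.
      by apply/funext => w; rewrite /F0r wtE.
    apply: measurable_funM => //.
    by case: (valid om); [exact: pH_m|exact: measurable_cst].
  have F0 om w : (0 <= F om w)%E.
    by rewrite lee_fin mulr_ge0 // wt_ge0.
  have h1 om : (P ([set w | bad (code w)] `&` At th `&` [set w | code w = om]) <=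
      \int[P]_(w in At th) F om w)%E.
    have [/andP[vom bom]|nvb] := boolP (valid om && bad om); last first.
      suff -> : [set w | bad (code w)] `&` At th `&` [set w | code w = om] = set0.
        by rewrite measure0; exact: integral_ge0.
      apply/seteqP; split => // w [[/= bw _] cw]; move/negP: nvb; apply.
      rewrite -cw bw andbT; apply/forallP => e; rewrite /code ffunE.
      by apply/implyP => /andP[].
    have cE : [set w | code w = om] = [set w | adj (G w) =2 adj (graph_of om)].
      apply/seteqP; split => w /=; first by move=> <-; exact: adj_code.
      move=> h; apply/ffunP => -[i j]; rewrite ffunE h /= /edge.
      have /forallP /(_ (i, j)) /= := vom.
      case: (ltngtP i j) => ij /=; first by rewrite orbF.
        by rewrite implybF => /negbTE ->.
      by rewrite implybF => /negbTE ->.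
    apply: (@le_trans _ _ (P (At th `&` [set w | adj (G w) =2 adj (graph_of om)]))).
      rewrite -cE; apply: le_measure; rewrite ?inE.
      - by apply: measurableI; [exact: measurableI|exact: code_m].
      - by apply: measurableI => //; exact: code_m.
      - by move=> w [[_ ?] ?].
    have [_ h] := Xcond (graph_of om); rewrite (h _ (At_C th)).
    rewrite le_eqVlt; apply/orP; left; apply/eqP; apply: eq_integral => w _.
    by rewrite /F /F0r /= wtE vom bom mul1r.
  apply: (le_trans (lee_sum _ (fun om _ => h1 om))).
  (* Inside the integral the sum over codes is an expectation under the law [pw w], hence at most
     [del]. *)
  rewrite -ge0_integral_sum //.
  rewrite -integral_cst //; apply: ge0_le_integral => //.
  - by move=> w _; exact: sume_ge0.
  - by apply: emeasurable_sum => om; exact: F_m.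
  - move=> w Aw; rewrite sumEFin lee_fin.
    apply: le_trans (bad_le gth (pw_p w) (pw_b w Aw)).
    by rewrite /Ex; apply: ler_sum => om _; rewrite mulrC.
apply: leeD.
  rewrite -sumEFin; apply: lee_sum => th _; rewrite -At_P.
  apply: le_measure; [by rewrite inE; exact: (measurableI _ _ bad_m (At_m th))|by rewrite inE; exact: At_m|by move=> w []].
apply: (@le_trans _ _ (\sum_(th | good th) del%:E * P (At th))%E).
  exact: lee_sum.
rewrite -ge0_sume_distrr; last by move=> th _; exact: measure_ge0.
rewrite -[leRHS]mule1 lee_wpmul2l ?lee_fin //.
apply: (@le_trans _ _ (\sum_th P (At th))%E).
  by rewrite [leRHS](bigID good) /= leeDl // sume_ge0.
rewrite -(probability_setT P) (measure_fiber_sum P (f := ty)) //.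
by rewrite le_eqVlt; apply/orP; left; apply/eqP; apply: eq_bigr => th _; rewrite setTI.
Qed.

End Transfer.

(** * Step functions and the lower bound on phi *)

Lemma uniform_prob01E (R : realType) (A : set R) : measurable A ->
  uniform_prob (@ltr01 R) A = lebesgue_measure (A `&` `[0, 1]%classic).
Proof.
move=> mA; rewrite /uniform_prob integral_uniform_pdf.
rewrite (eq_integral (cst 1%E)); last first.
  by move=> x; rewrite inE /= => -[_]; rewrite in_itv /= /uniform_pdf => ->; rewrite subr0 invr1.
by rewrite integral_cst ?mul1e //; exact: measurableI.
Qed.

Section PartitionIndex.
Variable (R : realType).
Implicit Types (s : seq R) (x : R).

(* Points to the right of the last element of s get the index [size s], for
   which [part_itv s (size s)] is empty. *)
Definition pidx s x : nat := find (fun y => x <= y) s.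

Lemma pidx_le_size s x : (pidx s x <= size s)%N.
Proof. exact: find_size. Qed.

Lemma partition_nth_le s i j : itv_partition 0 1 s -> (i <= j)%N ->
  (j < size s)%N -> s`_i <= s`_j.
Proof.
move=> [/path_sorted ss _] ij js.
apply: (sorted_leq_nth le_trans lexx) => //; first exact: (sub_sorted ltW ss).
exact: leq_ltn_trans js.
Qed.

Lemma pidx_ge s x i : itv_partition 0 1 s -> (i < size s)%N ->
  (pidx s x <= i)%N = (x <= s`_i).
Proof.
move=> hs si; apply/idP/idP => h.
  have hx : has (fun y => x <= y) s by rewrite has_find (leq_ltn_trans h).
  by apply: le_trans (nth_find 0 hx) _; exact: partition_nth_le.
by rewrite leqNgt; apply/negP => /(before_find 0); rewrite h.
Qed.

Lemma pidx_lt_size s x : itv_partition 0 1 s -> x <= 1 -> (pidx s x < size s)%N.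
Proof.
move=> hs x1; have [_ /eqP l1] := hs.
have s0 : (0 < size s)%N.
  by case: s hs l1 => //= _ /eqP; rewrite eq_sym oner_eq0.
rewrite -(prednK s0) ltnS pidx_ge ?prednK // nth_last.
by case: s l1 {hs} s0 => //= a s ->.
Qed.

Lemma pidx_part_itv s x : itv_partition 0 1 s -> 0 <= x <= 1 ->
  part_itv s (pidx s x) x.
Proof.
move=> hs /andP[x0 x1]; have sx := pidx_lt_size hs x1.
rewrite /part_itv /= in_itv /= -(pidx_ge _ hs sx) leqnn andbT.
move: sx; case e : (pidx s x) => [//|i] /= si.
rewrite leNgt; apply/negP => h; have := ltW h.
by rewrite -(pidx_ge _ hs (ltnW si)) e ltnn.
Qed.

Lemma pidx_set0 s : itv_partition 0 1 s -> (0 < size s)%N ->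
  [set x | pidx s x = 0%N] = `]-oo, s`_0]%classic.
Proof.
move=> hs s0; apply/seteqP; split => x /=; rewrite in_itv /= -(pidx_ge _ hs s0) leqn0.
  by move=> ->.
by move/eqP.
Qed.

Lemma pidx_setS s i : itv_partition 0 1 s -> (i.+1 < size s)%N ->
  [set x | pidx s x = i.+1] = `]s`_i, s`_i.+1]%classic.
Proof.
move=> hs si; apply/seteqP; split => x /=;
  rewrite in_itv /= ltNge -!(pidx_ge _ hs) ?(ltnW si) // -ltnNge.
  by move=> ->; rewrite !leqnn.
by rewrite -eqn_leq => /eqP.
Qed.

Lemma pidx_m s i : itv_partition 0 1 s -> measurable [set x | pidx s x = i].
Proof.
move=> hs; have [si|si] := ltnP i (size s).
  case: i si => [|i] si; first by rewrite pidx_set0 //; exact: measurable_itv.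
  by rewrite pidx_setS //; exact: measurable_itv.
have [->|ne] := eqVneq i (size s).
  rewrite (_ : [set x | _] = [set x | forall j : 'I_(size s), ~ (x <= s`_j)]).
    apply: measurable_forall_fin => j.
    have -> : [set x | ~ x <= s`_j] = ~` `]-oo, s`_j]%classic.
      by apply/seteqP; split => x /=; rewrite in_itv.
    by apply: measurableC; exact: measurable_itv.
  apply/seteqP; split => x /= h.
    by move=> j; rewrite -(pidx_ge _ hs) // h leqNgt ltn_ord.
  apply/eqP; rewrite eqn_leq pidx_le_size /= leqNgt; apply/negP => xs.
  by apply: (h (Ordinal xs)) => /=; rewrite -pidx_ge.
rewrite (_ : [set x | _] = set0); first exact: measurable0.
apply/seteqP; split => x //= h; move/eqP: ne; apply; apply/eqP.
by rewrite eqn_leq si -h pidx_le_size.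
Qed.

Lemma uniform_pidx s i : itv_partition 0 1 s -> (i < size s)%N ->
  uniform_prob (@ltr01 R) [set x | pidx s x = i] = (part_len s i)%:E.
Proof.
move=> hs si; rewrite uniform_prob01E; last exact: pidx_m.
have h0 j : (j < (size s).+1)%N -> 0 <= (0 :: s)`_j.
  move=> sj; rewrite (set_nth_default 1) //; exact: itv_partition_nth_ge.
have h1 j : (j < size s)%N -> s`_j <= 1.
  by move=> sj; rewrite (set_nth_default 1) //; exact: (@itv_partition_nth_le _ _ 0 1 s j.+1).
rewrite /part_len; case: i si => [|i] si /=.
  rewrite pidx_set0 //; have -> : `]-oo, s`_0]%classic `&` `[0, 1]%classic = `[0, s`_0]%classic :> set R.
    apply/seteqP; split => x /=; rewrite !in_itv /=.
      by move=> [-> /andP[->]].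
    by move=> /andP[-> h]; rewrite h (le_trans h (h1 _ si)).
  rewrite lebesgue_measure_itv /= lte_fin subr0; case: ltP => h.
    by rewrite -EFinB subr0.
  by congr EFin; apply/eqP; rewrite eq_le h (h0 1%N).
rewrite pidx_setS //; have -> : `]s`_i, s`_i.+1]%classic `&` `[0, 1]%classic = `]s`_i, s`_i.+1]%classic :> set R.
  apply/seteqP; split => x /=; rewrite !in_itv /=; first by move=> [-> _].
  move=> /andP[a b]; rewrite a b; split => //; rewrite (le_trans b (h1 _ si)) andbT.
  by apply: le_trans (ltW a); apply: (h0 i.+1); exact: ltnW.
rewrite lebesgue_measure_itv /= lte_fin; case: ltP => h; first by rewrite -EFinB.
by congr EFin; apply/eqP; rewrite eq_sym subr_eq0 eq_le h partition_nth_le.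
Qed.

End PartitionIndex.

Lemma marginal_sum (R : realType) (d : measure_display) (Om : measurableType d)
    (mu : probability Om R) (T K : finType) (tau : Om -> T) (f : T -> K) (F : K -> R) :
  (forall a, measurable [set x | tau x = a]) ->
  \sum_a F (f a) * fine (mu [set x | tau x = a]) =
  \sum_c F c * fine (mu [set x | f (tau x) = c]).
Proof.
move=> mt; rewrite (partition_big f predT) //=; apply: eq_bigr => c _.
have mc : measurable [set x | f (tau x) = c].
  exact: (@measurable_finType_pred _ Om _ tau (fun a => f a = c) mt).
rewrite (eq_bigr (fun a => F c * fine (mu [set x | tau x = a]))); last first.
  by move=> a /eqP ->.
rewrite -mulr_sumr; congr (_ * _); apply: EFin_inj.
rewrite fineK ?fin_num_measure // -sumEFin (measure_fiber_sum mu (f := tau)) //.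
rewrite big_mkcond /=; apply: eq_bigr => a _; case: eqP => fa.
  rewrite fineK ?fin_num_measure //; congr (mu _); apply/seteqP; split => x /=.
    by move=> e; rewrite e.
  by case.
rewrite (_ : _ `&` _ = set0) ?measure0 //; apply/seteqP; split => x //= [h e].
by apply: fa; rewrite -e.
Qed.

(** * Riemann sums rewritten as sums over types *)

Section Grid.
Variables (R : realType) (T : finType) (tau : R -> T).
Hypothesis tau_m : forall a, measurable [set x | tau x = a].
Variables (s t : seq R).
Hypothesis hs : itv_partition 0 1 s.
Hypothesis ht : itv_partition 0 1 t.
Let la a : R := fine (uniform_prob (@ltr01 R) [set x | tau x = a]).

(** The index [size r] collects the points to the right of 1, which belong to no cell; hence the
    condition that [F] vanishes there. *)
Lemma grid_sum1 (r : seq R) (rho : T -> 'I_(size r).+1) (F : nat -> R) :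
  itv_partition 0 1 r -> (forall x, rho (tau x) = pidx r x :> nat) -> F (size r) = 0 ->
  \sum_a F (rho a) * la a = \sum_(i < size r) F i * part_len r i.
Proof.
move=> hr rt F0.
rewrite [LHS](@marginal_sum R _ _ (uniform_prob (@ltr01 R)) T _ tau rho (fun i => F i) tau_m).
rewrite big_ord_recr /= F0 mul0r addr0; apply: eq_bigr => i _; congr (_ * _).
have -> : [set x | rho (tau x) = widen_ord (leqnSn (size r)) i] = [set x | pidx r x = i].
  apply/seteqP; split => x /=; first by move=> h; rewrite -rt h.
  by move=> h; apply/val_inj; rewrite /= rt.
by rewrite uniform_pidx.
Qed.

Lemma grid_sum2 (ps : T -> 'I_(size s).+1) (pt : T -> 'I_(size t).+1)
    (F : nat -> nat -> R) :
  (forall x, ps (tau x) = pidx s x :> nat) ->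
  (forall x, pt (tau x) = pidx t x :> nat) ->
  (forall j, F (size s) j = 0) -> (forall i, F i (size t) = 0) ->
  \sum_a \sum_b F (ps a) (pt b) * (la a * la b) =
  \sum_(i < size s) \sum_(j < size t) F i j * (part_len s i * part_len t j).
Proof.
move=> es et Fs Ft.
rewrite (eq_bigr (fun a => (\sum_(j < size t) F (ps a) j * part_len t j) * la a)).
  rewrite (grid_sum1 (rho := ps) (F := fun i => \sum_(j < size t) F i j * part_len t j)) //.
    by apply: eq_bigr => i _; rewrite mulr_suml; apply: eq_bigr => j _; ring.
  by apply: big1 => j _; rewrite Fs mul0r.
move=> a _; rewrite -(grid_sum1 (rho := pt) (F := fun j => F (ps a) j)) //.
by rewrite mulr_suml; apply: eq_bigr => b _; ring.
Qed.

End Grid.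

(** * Step kernels that squeeze a Riemann integrable graphon *)

Section RiemannStep.
Variables (R : realType) (W : R -> R -> R).
Hypothesis Wgr : is_graphon W.
Hypothesis Wri : riemann_integrable W.
Implicit Types (s t : seq R) (x y : R).
Let sig := sup [set W x y | x in `[0, 1] & y in `[0, 1]].

Lemma W_range x y : x \in `[0, 1] -> y \in `[0, 1] -> 0 <= W x y <= sig.
Proof.
move=> hx hy; have /andP[-> _] := graphon_range Wgr hx hy; apply: ub_le_sup.
  by exists 1 => _ [a ha [b hb <-]]; case/andP: (graphon_range Wgr ha hb).
by exists x => //; exists y.
Qed.

Lemma sig_ge0 : 0 <= sig.
Proof.
have h : (0 : R) \in `[0, 1] by rewrite in_itv /= lexx ler01.
by case/andP: (W_range h h) => /le_trans; apply.
Qed.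

Definition cell_values (s t : seq R) i j :=
  [set W x y | x in part_itv s i & y in part_itv t j].

Lemma part_itv_sub s i : itv_partition 0 1 s -> (i <= size s)%N ->
  part_itv s i `<=` `[0, 1].
Proof.
move=> hs si x; rewrite /part_itv /= !in_itv /= => /andP[h1 h2].
have h0 : 0 <= (0 :: s)`_i.
  by rewrite (set_nth_default 1) //; exact: itv_partition_nth_ge.
rewrite (le_trans h0 h1) /=; move: si; rewrite leq_eqVlt => /orP[/eqP e|si].
  by apply: (le_trans h2); rewrite e nth_default // ler01.
apply: (le_trans h2); rewrite (set_nth_default 1) //.
exact: (@itv_partition_nth_le _ _ 0 1 s i.+1).
Qed.

Lemma part_itv_out s : itv_partition 0 1 s -> part_itv s (size s) = set0.
Proof.
move=> hs; apply/seteqP; split => x //; rewrite /part_itv /= in_itv /=.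
rewrite (itv_partition_nth_size 0 hs) nth_default // => /andP[h1 h2].
by have := le_trans h1 h2; rewrite ler10.
Qed.

Lemma cell_values_sub s t i j : itv_partition 0 1 s -> itv_partition 0 1 t ->
  (i <= size s)%N -> (j <= size t)%N ->
  forall z, cell_values s t i j z -> 0 <= z <= sig.
Proof.
move=> hs ht si tj _ [x hx [y hy <-]].
by apply: W_range; [exact: part_itv_sub hx|exact: part_itv_sub hy].
Qed.

Lemma sup_inf_range (E : set R) : (forall z, E z -> 0 <= z <= sig) ->
  (0 <= sup E <= sig) /\ (0 <= inf E <= sig).
Proof.
move=> hE; have [->|/set0P[z Ez]] := eqVneq E set0.
  by rewrite sup0 inf0 lexx sig_ge0.
have ne : E !=set0 by exists z.
have ub : has_ubound E by exists sig => x /hE /andP[].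
have lb : has_lbound E by exists 0 => x /hE /andP[].
have /andP[z0 zs] := hE _ Ez.
split; apply/andP; split.
- by apply: le_trans z0 _; exact: ub_le_sup.
- by apply: ge_sup => // x /hE /andP[].
- by apply: lb_le_inf => // x /hE /andP[].
- by apply: le_trans zs; apply: ge_inf.
Qed.

Lemma cell_sup_inf s t x y : itv_partition 0 1 s -> itv_partition 0 1 t ->
  x \in `[0, 1] -> y \in `[0, 1] ->
  inf (cell_values s t (pidx s x) (pidx t y)) <= W x y <=
  sup (cell_values s t (pidx s x) (pidx t y)).
Proof.
move=> hs ht hx hy.
have hE := cell_values_sub hs ht (pidx_le_size s x) (pidx_le_size t y).
have EW : cell_values s t (pidx s x) (pidx t y) (W x y).
  exists x; first by apply: pidx_part_itv => //; move: hx; rewrite in_itv.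
  by exists y => //; apply: pidx_part_itv => //; move: hy; rewrite in_itv.
apply/andP; split.
  by apply: ge_inf => //; exists 0 => z /hE /andP[].
by apply: ub_le_sup => //; exists sig => z /hE /andP[].
Qed.

(** The infimum of the upper sums equals the supremum of the lower sums, and each is approached
    within [e / 2]. The four partitions need not be related. *)
Lemma upper_lower_close (e : R) : 0 < e -> exists s t s' t' : seq R,
  [/\ itv_partition 0 1 s, itv_partition 0 1 t,
      itv_partition 0 1 s', itv_partition 0 1 t' &
      upper_sum W s t - lower_sum W s' t' <= e].
Proof.
move=> e0; have [_ eq_int] := Wri.
have p1 : itv_partition 0 (1 : R) [:: 1] by apply: itv_partition1; exact: ltr01.
have len_ge0 s i : itv_partition 0 1 s -> (i < size s)%N -> 0 <= part_len s i.
  move=> hs si; rewrite -lee_fin -uniform_pidx //; apply: measure_ge0.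
have len_sum s : itv_partition 0 1 s -> \sum_(i < size s) part_len s i <= 1.
  move=> hs; pose f x : 'I_(size s).+1 := inord (pidx s x).
  have fE x : f x = pidx s x :> nat by rewrite inordK // ltnS pidx_le_size.
  have fm a : measurable [set x | f x = a].
    rewrite (_ : [set x | _] = [set x | pidx s x = a]); first exact: pidx_m.
    by apply/seteqP; split => x /= h; [rewrite -h fE|apply/val_inj; rewrite /= fE].
  have := @measure_fiber_sum R _ _ (uniform_prob (@ltr01 R)) _ f setT fm measurableT.
  rewrite [LHS](_ : _ = 1%E); last exact: (probability_setT (uniform_prob (@ltr01 R))).
  rewrite big_ord_recr /= => h.
  rewrite -lee_fin [leRHS]h -sumEFin; apply: le_trans (leeDl _ (measure_ge0 _ _)).
  rewrite le_eqVlt; apply/orP; left; apply/eqP; apply: eq_bigr => i _.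
  rewrite -uniform_pidx // setTI; congr (uniform_prob _ _).
  apply/seteqP; split => x /= hx; last by rewrite -fE hx.
  by apply/val_inj; rewrite /= fE.
have hi : has_inf [set upper_sum W s t | s in itv_partition 0 1 & t in itv_partition 0 1].
  split; first by exists (upper_sum W [:: 1] [:: 1]); exists [:: 1] => //; exists [:: 1].
  exists 0 => _ [s hs [t ht <-]]; apply: sumr_ge0 => i _; apply: sumr_ge0 => j _.
  apply: mulr_ge0; last by rewrite mulr_ge0 // len_ge0.
  have [/andP[] //] := sup_inf_range (cell_values_sub hs ht (ltnW (ltn_ord i)) (ltnW (ltn_ord j))).
have hsu : has_sup [set lower_sum W s t | s in itv_partition 0 1 & t in itv_partition 0 1].
  split; first by exists (lower_sum W [:: 1] [:: 1]); exists [:: 1] => //; exists [:: 1].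
  exists sig => _ [s hs [t ht <-]].
  apply: (@le_trans _ _ (\sum_(i < size s) \sum_(j < size t) sig * (part_len s i * part_len t j))).
    apply: ler_sum => i _; apply: ler_sum => j _; apply: ler_wpM2r.
      by rewrite mulr_ge0 // len_ge0.
    by have [_ /andP[]] := sup_inf_range (cell_values_sub hs ht (ltnW (ltn_ord i)) (ltnW (ltn_ord j))).
  rewrite (eq_bigr (fun i : 'I__ => sig * part_len s i * \sum_(j < size t) part_len t j)); last first.
    by move=> i _; rewrite mulr_sumr; apply: eq_bigr => j _; rewrite mulrA.
  rewrite -mulr_suml -mulr_sumr -mulrA ler_piMr ?sig_ge0 // mulr_ile1 ?len_sum //.
    by apply: sumr_ge0 => i _; exact: len_ge0.
  by apply: sumr_ge0 => i _; exact: len_ge0.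
have e2 : 0 < e / 2 by rewrite divr_gt0.
have [_ [s hs [t ht <-]] h1] := inf_adherent e2 hi.
have [_ [s' hs' [t' ht' <-]] h2] := sup_adherent e2 hsu.
exists s, t, s', t'; split => //.
move: eq_int h1 h2; rewrite /lower_integral /upper_integral => ->.
set X := inf _ => h1 h2; lra.
Qed.

(** In place of a common refinement, a type records the index of a point in all four partitions of
    [upper_lower_close], and each step function reads the two that it needs. *)
Lemma riemann_step (e : R) : 0 < e -> exists (T : finType) (tau : R -> T)
  (U L : T -> T -> R),
  [/\ forall a, measurable [set x | tau x = a],
      forall a b, [/\ 0 <= L a b, L a b <= U a b & U a b <= sig],
      forall a b, U a b = U b a,
      forall x y, x \in `[0, 1] -> y \in `[0, 1] ->
        L (tau x) (tau y) <= W x y <= U (tau x) (tau y) &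
      \sum_a \sum_b (U a b - L a b) *
        (fine (uniform_prob (@ltr01 R) [set x | tau x = a]) *
         fine (uniform_prob (@ltr01 R) [set x | tau x = b])) <= e].
Proof.
move=> /upper_lower_close [s [t [s' [t' [hs ht hs' ht' hle]]]]].
pose f (r : seq R) (x : R) : 'I_(size r).+1 := inord (pidx r x).
have fE r x : f r x = pidx r x :> nat by rewrite inordK // ltnS pidx_le_size.
have fm r a : itv_partition 0 1 r -> measurable [set x | f r x = a].
  move=> hr; rewrite (_ : [set x | _] = [set x | pidx r x = a]); first exact: pidx_m.
  by apply/seteqP; split => x /= h; [rewrite -h fE|apply/val_inj; rewrite /= fE].
pose T : finType := ('I_(size s).+1 * 'I_(size t).+1 * ('I_(size s').+1 * 'I_(size t').+1))%type.
pose tau x : T := ((f s x, f t x), (f s' x, f t' x)).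
have tau_m a : measurable [set x | tau x = a].
  have -> : [set x | tau x = a] = ([set x | f s x = a.1.1] `&` [set x | f t x = a.1.2]) `&`
     ([set x | f s' x = a.2.1] `&` [set x | f t' x = a.2.2]).
    case: a => [[a1 a2] [a3 a4]]; apply/seteqP; split => x /=; first by move=> [-> -> -> ->].
    by move=> [[<- <-] [<- <-]].
  by apply: measurableI; apply: measurableI; exact: fm.
pose la a := fine (uniform_prob (@ltr01 R) [set x | tau x = a]).
pose U0 (a b : T) := sup (cell_values s t a.1.1 b.1.2).
pose L0 (a b : T) := inf (cell_values s' t' a.2.1 b.2.2).
(* [s] and [t] may differ, so [U0] need not be symmetric; by symmetry of W the minimum still
   dominates W. *)
pose U a b := Num.min (U0 a b) (U0 b a).
(* [L0 <= U] is ensured by W only at types taken by points of [0,1]; the minimum ensures it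
   everywhere. *)
pose L a b := Num.min (L0 a b) (U a b).
have leS (X : Type) (r : seq X) (i : 'I_(size r).+1) : (i <= size r)%N by rewrite -ltnS.
have U0r a b : 0 <= U0 a b <= sig.
  by have [] := sup_inf_range (cell_values_sub hs ht (leS _ _ a.1.1) (leS _ _ b.1.2)).
have L0r a b : 0 <= L0 a b <= sig.
  by have [] := sup_inf_range (cell_values_sub hs' ht' (leS _ _ a.2.1) (leS _ _ b.2.2)).
have WU0 x y : x \in `[0, 1] -> y \in `[0, 1] -> W x y <= U0 (tau x) (tau y).
  by move=> hx hy; have /andP[_] := cell_sup_inf hs ht hx hy; rewrite /U0 /= !fE.
have WL0 x y : x \in `[0, 1] -> y \in `[0, 1] -> L0 (tau x) (tau y) <= W x y.
  by move=> hx hy; have /andP[] := cell_sup_inf hs' ht' hx hy; rewrite /L0 /= !fE.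
have WU x y : x \in `[0, 1] -> y \in `[0, 1] -> W x y <= U (tau x) (tau y).
  by move=> hx hy; rewrite le_min WU0 //= (graphon_sym Wgr) // WU0.
exists T, tau, U, L; split => //.
- move=> a b; split.
  + by rewrite !le_min; case/andP: (L0r a b) => ->; case/andP: (U0r a b) => ->; case/andP: (U0r b a) => ->.
  + by rewrite ge_min lexx orbT.
  + by rewrite ge_min; case/andP: (U0r a b) => _ ->.
- by move=> a b; rewrite /U minC.
- move=> x y hx hy; rewrite WU // andbT.
  by apply: le_trans (WL0 _ _ hx hy); rewrite ge_min lexx.
have la0 a : 0 <= la a by apply: fine_ge0; exact: measure_ge0.
(* Types of positive mass are taken in [0,1], where [L0] and [U] can be compared through W; the
   others contribute 0. *)
have la_ne a : la a != 0 -> exists2 x, x \in `[0, 1] & tau x = a.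
  move=> h; apply/not_exists2P => hx; move/eqP: h; apply.
  rewrite /la uniform_prob01E // (_ : _ `&` _ = set0) ?measure0 //.
  by apply/seteqP; split => x //= [xa x01]; case: (hx x).
apply: le_trans hle.
have empty_l r r' j : itv_partition 0 1 r -> cell_values r r' (size r) j = set0.
  by move=> hr; apply/seteqP; split => z // [x]; rewrite part_itv_out.
have empty_r r r' i : itv_partition 0 1 r' -> cell_values r r' i (size r') = set0.
  by move=> hr; apply/seteqP; split => z // [x _ [y]]; rewrite part_itv_out.
have eU : upper_sum W s t = \sum_a \sum_b U0 a b * (la a * la b).
  apply/esym; apply: (@grid_sum2 R T tau tau_m s t hs ht (fun a => a.1.1)
    (fun a => a.1.2) (fun i j => sup (cell_values s t i j))) => [x|x|j|i].
  - by rewrite /= fE.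
  - by rewrite /= fE.
  - by rewrite empty_l // sup0.
  - by rewrite empty_r // sup0.
have eL : lower_sum W s' t' = \sum_a \sum_b L0 a b * (la a * la b).
  apply/esym; apply: (@grid_sum2 R T tau tau_m s' t' hs' ht' (fun a => a.2.1)
    (fun a => a.2.2) (fun i j => inf (cell_values s' t' i j))) => [x|x|j|i].
  - by rewrite /= fE.
  - by rewrite /= fE.
  - by rewrite empty_l // inf0.
  - by rewrite empty_r // inf0.
have -> : upper_sum W s t - lower_sum W s' t' =
   \sum_a \sum_b (U0 a b - L0 a b) * (la a * la b).
  rewrite eU eL -sumrB; apply: eq_bigr => a _; rewrite -sumrB; apply: eq_bigr => b _.
  by rewrite mulrBl.
apply: ler_sum => a _; apply: ler_sum => b _.
have [ab|] := eqVneq (la a * la b) 0; first by rewrite -/(la a) -/(la b) ab !mulr0.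
rewrite mulf_eq0 negb_or => /andP[/la_ne [x hx xa] /la_ne [y hy yb]].
apply: ler_wpM2r; first exact: mulr_ge0 (la0 a) (la0 b).
apply: lerB; first by rewrite /U ge_min lexx.
rewrite /L le_min lexx /= -xa -yb; apply: le_trans (WL0 _ _ hx hy) (WU _ _ hx hy).
Qed.

End RiemannStep.

(* Spares the measurability of the inner integrals in [phi]. *)
Lemma ge0_le_integral_nomeas (R : realType) (d : measure_display)
    (Om : measurableType d) (mu : {measure set Om -> \bar R}) (D : set Om)
    (f g : Om -> \bar R) :
  (forall x, D x -> (0 <= f x)%E) -> (forall x, D x -> (f x <= g x)%E) ->
  (\int[mu]_(x in D) f x <= \int[mu]_(x in D) g x)%E.
Proof.
move=> f0 fg; have g0 x : D x -> (0 <= g x)%E by move=> Dx; exact: le_trans (f0 x Dx) (fg x Dx).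
rewrite !ge0_integralE //; apply: le_ereal_sup => _ [h hf <-]; exists h => // x.
apply: le_trans (hf x) _; rewrite /patch; case: ifP => // /set_mem; exact: fg.
Qed.

Lemma integral_step (R : realType) (d : measure_display)
    (Om : measurableType d) (mu : {measure set Om -> \bar R}) (D : set Om)
    (T : finType) (f : Om -> T) (g : T -> R) :
  measurable D -> (forall a, measurable [set x | f x = a]) ->
  (forall a, 0 <= g a) ->
  (\int[mu]_(x in D) (g (f x))%:E =
   \sum_a (g a)%:E * mu (D `&` [set x | f x = a]))%E.
Proof.
move=> mD mf g0.
rewrite (eq_integral (fun x => \sum_a (g a)%:E * (\1_[set x | f x = a] x)%:E)%E); last first.
  move=> x _; rewrite (bigD1 (f x)) //= big1 ?adde0; last first.
    move=> a /eqP ne; rewrite indicE memNset ?mule0 // => e; exact: ne.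
  by rewrite indicE mem_set // mule1.
have mI a : measurable_fun D (fun x => (\1_[set x | f x = a] x)%:E : \bar R).
  by apply/measurable_EFinP; apply: measurable_funTS; exact: measurable_indic.
rewrite ge0_integral_sum //.
- apply: eq_bigr => a _; rewrite ge0_integralZl ?lee_fin //.
  by rewrite integral_indic // setIC.
- by move=> a; apply: measurable_funeM.
- by move=> a x _; rewrite mule_ge0 // lee_fin.
Qed.

(** * Comparison of phi with its discretisation *)

Section PhiLower.
Variables (R : realType) (W : R -> R -> R) (sig : R).
Hypothesis sig1 : sig < 1.
Variable mu : probability R R.
Hypothesis mu01 : mu `[0, 1]%classic = 1%E.
Variables (T : finType) (tau : R -> T) (L : T -> T -> R).
Hypothesis tau_m : forall a, measurable [set x | tau x = a].
Hypothesis L_rng : forall a b, 0 <= L a b <= sig.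
Hypothesis W_rng : forall x y, x \in `[0, 1] -> y \in `[0, 1] ->
  L (tau x) (tau y) <= W x y <= sig.

Let m a : R := fine (mu [set x | tau x = a]).
Let kL a b : R := - ln (1 - L a b).

Lemma kL_ge0 a b : 0 <= kL a b.
Proof. by rewrite /kL oppr_ge0 ln_le0 // gerBl; case/andP: (L_rng a b). Qed.

Lemma mass_ge0 a : 0 <= m a.
Proof. exact: fine_ge0 (measure_ge0 _ _). Qed.

(** Type classes may stick out of [0,1], but only in a [mu]-null set. *)
Lemma mu_cap (S : pred T) a :
  mu ((`[0, 1]%classic `&` [set x | S (tau x)]) `&` [set x | tau x = a]) =
  ((if S a then m a else 0)%:E).
Proof.
case: ifP => Sa.
  rewrite /m fineK ?fin_num_measure //.
  have -> : `[0, 1]%classic `&` [set x | S (tau x)] `&` [set x | tau x = a] =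
     [set x | tau x = a] `&` `[0, 1]%classic.
    apply/seteqP; split => x /=; first by move=> [[? _] ?].
    by move=> [e ?]; rewrite e.
  rewrite -[in RHS](setIT [set x | tau x = a]) -(setUv `[0, 1]%classic).
  rewrite setIUr [RHS]measureU /=.
  - rewrite [X in (_ + X)%E](_ : _ = 0%E) ?adde0 //.
    apply/eqP; rewrite eq_le measure_ge0 andbT.
    apply: (@le_trans _ _ (mu (~` `[0, 1]%classic))); first by apply: measureIr => //; exact: measurableC.
    by rewrite probability_setC // mu01 subee.
  - exact: measurableI.
  - by apply: measurableI => //; exact: measurableC.
  - by apply/seteqP; split => x // [[_ h] [_ h']].
rewrite (_ : _ `&` _ = set0) ?measure0 //.
by apply/seteqP; split => x //= [[_ h] e]; move: h; rewrite e Sa.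
Qed.

(** Tests [phi] on the points of [0,1] with type in [S], where [W >= L] makes the integrand at least
    the step function [kL]. *)
Lemma phi_ge (S : pred T) : 0 < \sum_(a | S a) m a ->
  (((\sum_(a | S a) m a)^-1 * \sum_(a | S a) \sum_(b | S b) m a * m b * kL a b)%:E
   <= phi mu W)%E.
Proof.
move=> S0; pose D := `[0, 1]%classic `&` [set x | S (tau x)].
have mD : measurable D.
  apply: measurableI => //.
  exact: (@measurable_finType_pred _ _ _ tau (fun a => S a) tau_m).
have muD : mu D = (\sum_(a | S a) m a)%:E.
  rewrite (measure_fiber_sum mu tau_m mD) -sumEFin [RHS]big_mkcond /=.
  by apply: eq_bigr => a _; rewrite /D mu_cap; case: ifP.
have D01 x : D x -> x \in `[0, 1] by case.
have lne_ge x y : D x -> D y -> ((kL (tau x) (tau y))%:E <= lne (1 / (1 - W x y)%:E))%E.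
  move=> Dx Dy; have /andP[LW Ws] := W_rng (D01 _ Dx) (D01 _ Dy).
  have W1 : 0 < 1 - W x y by rewrite subr_gt0 (le_lt_trans Ws).
  rewrite mul1e inver gt_eqF // lne_EFin ?invr_gt0 // lnV // lee_fin lerN2 ler_ln ?posrE //.
    by rewrite lerB.
  by apply: (lt_le_trans W1); rewrite lerB.
apply: (@le_trans _ _ ((mu D)^-1 * \int[mu]_(y in D) \int[mu]_(x in D)
   lne (1 / (1 - W x y)%:E))%E); last first.
  apply: ereal_sup_ubound; exists D => //.
  by split; [exact: mD|move=> x []|rewrite muD lte_fin].
rewrite muD inver gt_eqF // EFinM lee_pmul2l ?lte_fin ?invr_gt0 //.
pose g b := \sum_(a | S a) kL a b * m a.
have g0 b : 0 <= g b.
  by apply: sumr_ge0 => a _; rewrite mulr_ge0 ?kL_ge0 ?mass_ge0.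
apply: (@le_trans _ _ (\int[mu]_(y in D) (g (tau y))%:E)%E).
  rewrite (integral_step mu mD tau_m g0).
  rewrite (eq_bigr (fun a => (g a * if S a then m a else 0)%:E)); last first.
    by move=> a _; rewrite [X in (_ * X)%E](mu_cap S a).
  rewrite sumEFin lee_fin exchange_big big_mkcond /= le_eqVlt; apply/orP; left; apply/eqP.
  apply: eq_bigr => b _; case: ifP => Sb; last by rewrite mulr0.
  by rewrite /g mulr_suml; apply: eq_bigr => a _; ring.
apply: ge0_le_integral_nomeas => y Dy; first by rewrite lee_fin.
apply: (@le_trans _ _ (\int[mu]_(x in D) (kL (tau x) (tau y))%:E)%E).
  rewrite (integral_step mu mD tau_m (g := fun a => kL a (tau y))); last first.
    by move=> a; exact: kL_ge0.
  rewrite (eq_bigr (fun a => (kL a (tau y) * if S a then m a else 0)%:E)); last first.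
    by move=> a _; rewrite [X in (_ * X)%E](mu_cap S a).
  rewrite sumEFin lee_fin /g big_mkcond le_eqVlt; apply/orP; left; apply/eqP.
  by apply: eq_bigr => a _; case: ifP; rewrite ?mulr0.
apply: ge0_le_integral_nomeas => x Dx; first by rewrite lee_fin kL_ge0.
exact: lne_ge.
Qed.

Lemma mass_sum1 : \sum_a m a = 1.
Proof.
apply: EFin_inj; apply: etrans (probability_setT mu).
rewrite -sumEFin [RHS](measure_fiber_sum mu tau_m measurableT).
by apply: eq_bigr => a _; rewrite setTI /m fineK // fin_num_measure.
Qed.

Lemma phi_ge0 : (0 <= phi mu W)%E.
Proof.
have := @phi_ge predT; rewrite mass_sum1 => /(_ ltr01); apply: le_trans.
rewrite lee_fin mulr_ge0 ?invr_ge0 // sumr_ge0 // => a _; rewrite sumr_ge0 // => b _.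
by rewrite !mulr_ge0 ?mass_ge0 ?kL_ge0.
Qed.

Variables (U : T -> T -> R) (al e e1 : R).
Let la a : R := fine (uniform_prob (@ltr01 R) [set x | tau x = a]).
Let kU a b : R := - ln (1 - U a b).
Let K := - ln (1 - sig).
Hypothesis LU : forall a b, L a b <= U a b <= sig.
Hypothesis al0 : 0 < al.
Hypothesis mu_la : forall a, al * m a <= la a.
Hypothesis close : \sum_a \sum_b (U a b - L a b) * (la a * la b) <= e.
Hypothesis e10 : 0 < e1.
Hypothesis e_small : e <= e1 ^+ 2 * (1 - sig) * al ^+ 2 / (K + 1).

Definition quad_ratio (S : {set T}) : R :=
  (\sum_(a in S) m a)^-1 * \sum_(a in S) \sum_(b in S) m a * m b * kU a b.

(* [quad_ratio S] is 0 when S has mass 0. *)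
Definition Phi : R := \big[Num.max/0]_(S : {set T}) quad_ratio S.

Lemma kU_bnd a b : 0 <= kU a b <= K.
Proof.
have /andP[h1 h2] := LU a b; have /andP[h3 h4] := L_rng a b.
rewrite /kU /K oppr_ge0 ln_le0 /=; last by rewrite gerBl (le_trans h3).
by rewrite lerN2 ler_ln ?posrE ?subr_gt0 ?(le_lt_trans h2) // lerB.
Qed.

Lemma K_ge0 : 0 <= K.
Proof.
have [/card_gt0P[a _]|] := ltnP 0 #|T|.
  by have /andP[h1 /(le_trans h1)] := kU_bnd a a.
rewrite leqn0 => /eqP T0; have := mass_sum1.
rewrite big1; last by move=> a; have := max_card (pred1 a); rewrite card1 T0.
by move=> /eqP; rewrite eq_sym oner_eq0.
Qed.

Lemma Phi_ge0 : 0 <= Phi.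
Proof. by rewrite /Phi; elim/big_rec: _ => // S x _ x0; rewrite le_max x0 orbT. Qed.

Lemma Phi_vertex (S : {set T}) :
  \sum_(a in S) \sum_(b in S) m a * m b * kU a b <= Phi * \sum_(a in S) m a.
Proof.
have s0 : 0 <= \sum_(a in S) m a by apply: sumr_ge0 => a _; exact: mass_ge0.
have [s00|ne] := eqVneq (\sum_(a in S) m a) 0.
  rewrite s00 mulr0 big1 // => a aS; rewrite big1 // => b bS.
  have /allP h : all (fun a => (a \in S) ==> (m a == 0)) (index_enum T).
    by rewrite -psumr_eq0 ?s00 // => c _; exact: mass_ge0.
  by have := h a (mem_index_enum a); rewrite aS => /eqP ->; rewrite !mul0r.
have sp : 0 < \sum_(a in S) m a by rewrite lt_neqAle eq_sym ne.
rewrite -ler_pdivrMr // mulrC.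
exact: (@le_bigmax_cond _ _ _ 0 S predT quad_ratio).
Qed.

(** The logarithm has slope at most [1 / (1 - sig)] above [1 - sig], where both [1 - U] and [1 - L]
    lie. *)
Lemma kU_kL a b : kU a b - kL a b <= (U a b - L a b) / (1 - sig).
Proof.
have /andP[h1 h2] := LU a b; have /andP[h3 h4] := L_rng a b.
have U1 : 0 < 1 - U a b by rewrite subr_gt0 (le_lt_trans h2).
have L1 : 0 < 1 - L a b by rewrite subr_gt0 (le_lt_trans h4).
have s1 : 0 < 1 - sig by rewrite subr_gt0.
have -> : kU a b - kL a b = ln (1 + (U a b - L a b) / (1 - U a b)).
  have -> : 1 + (U a b - L a b) / (1 - U a b) = (1 - L a b) / (1 - U a b).
    by field; rewrite gt_eqF.
  by rewrite ln_div ?posrE // /kU /kL opprK addrC.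
have d0 : 0 <= (U a b - L a b) / (1 - U a b) by rewrite divr_ge0 ?subr_ge0 // -subr_ge0 ltW.
apply: (@le_trans _ _ ((U a b - L a b) / (1 - U a b))).
  by apply: le_ln1Dx; apply: lt_le_trans d0; rewrite oppr_lt0.
by rewrite ler_wpM2l ?subr_ge0 // lef_pV2 ?posrE // lerB.
Qed.

(** If [S] has mass at most [e1 / (K + 1)], its ratio is at most [K] times the mass, so below [e1].
    For heavier [S] the forms of [U] and [L] are compared: [al * m <= la] turns closeness in uniform
    measure into closeness in [mu] at the price [al^-2], and the division by the mass is
    affordable. *)
Lemma Phi_le_phi : (Phi%:E <= phi mu W + e1%:E)%E.
Proof.
have he : 0 < e1 := e10.
have K0 := K_ge0.
have s1 : 0 < 1 - sig by rewrite subr_gt0.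
rewrite /Phi; elim/big_rec: _ => [|S x _ xle].
  by rewrite adde_ge0 ?phi_ge0 // lee_fin ltW.
have [_|_] := leP (quad_ratio S) x; first exact: xle.
rewrite /quad_ratio; set s := \sum_(a in S) m a.
have s0 : 0 <= s by apply: sumr_ge0 => a _; exact: mass_ge0.
have [->|ne] := eqVneq s 0.
  by rewrite invr0 mul0r adde_ge0 ?phi_ge0 // lee_fin ltW.
have sp : 0 < s by rewrite lt_neqAle eq_sym ne.
have q_le : \sum_(a in S) \sum_(b in S) m a * m b * kU a b <= K * s ^+ 2.
  rewrite expr2 /s mulr_suml mulr_sumr; apply: ler_sum => a _.
  rewrite mulr_sumr mulr_sumr; apply: ler_sum => b _; rewrite mulrC.
  by rewrite ler_wpM2r ?mulr_ge0 ?mass_ge0 //; case/andP: (kU_bnd a b).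
have [ss|ss] := lerP s (e1 / (K + 1)).
  apply: (@le_trans _ _ e1%:E); last by rewrite leeDr ?phi_ge0.
  rewrite lee_fin mulrC ler_pdivrMr //; apply: (le_trans q_le).
  rewrite expr2 mulrA ler_wpM2r //; move: ss; rewrite ler_pdivlMr; last by lra.
  by move=> h; apply: le_trans h; rewrite mulrDr mulr1 mulrC lerDl.
have diff : \sum_(a in S) \sum_(b in S) m a * m b * kU a b <=
    \sum_(a in S) \sum_(b in S) m a * m b * kL a b + e / (1 - sig) / al ^+ 2.
  have -> : e / (1 - sig) / al ^+ 2 = e * ((1 - sig)^-1 / al ^+ 2) by rewrite mulrA.
  have c0 : 0 <= (1 - sig)^-1 / al ^+ 2 by rewrite divr_ge0 ?invr_ge0 ?sqr_ge0 // ltW.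
  have h := ler_wpM2r c0 close.
  rewrite addrC -lerBlDr -sumrB; apply: le_trans h.
  rewrite mulr_suml [leLHS]big_mkcond /=; apply: ler_sum => a _.
  have t0 b : 0 <= (U a b - L a b) * (la a * la b) * ((1 - sig)^-1 / al ^+ 2).
    have /andP[h1 _] := LU a b.
    by rewrite !mulr_ge0 ?subr_ge0 // ?invr_ge0 ?sqr_ge0 ?(ltW s1) //; exact: fine_ge0 (measure_ge0 _ _).
  rewrite mulr_suml; case: ifP => _; last by apply: sumr_ge0.
  rewrite -sumrB [leLHS]big_mkcond /=; apply: ler_sum => b _.
  case: ifP => _; last exact: t0.
  have /andP[h1 _] := LU a b.
  rewrite -mulrBr; apply: le_trans (ler_wpM2l _ (kU_kL a b)) _.
    by rewrite mulr_ge0 ?mass_ge0.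
  rewrite [leRHS](_ : _ = (la a * la b / al ^+ 2) * ((U a b - L a b) / (1 - sig))); last by ring.
  apply: ler_wpM2r; first by rewrite divr_ge0 ?subr_ge0 // -subr_ge0 ltW.
  rewrite ler_pdivlMr ?exprn_gt0 // (_ : _ * al ^+ 2 = (al * m a) * (al * m b)); last by ring.
  by apply: ler_pM => //; rewrite mulr_ge0 ?mass_ge0 ?(ltW al0).
have := @phi_ge (fun a => a \in S) sp; rewrite -/s => hphi.
apply: (@le_trans _ _ ((s^-1 * \sum_(a in S) \sum_(b in S) m a * m b * kL a b)%:E + e1%:E)%E); last first.
  exact: leeD.
rewrite -EFinD lee_fin.
apply: le_trans (ler_wpM2l _ diff) _; first by rewrite invr_ge0.
rewrite mulrDr lerD2l mulrC ler_pdivrMr //.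
(* The mass [s] exceeds [e1 / (K + 1)], and [e_small] says that [e / (1 - sig) / al^2] is at most
   [e1^2 / (K + 1)]. *)
apply: (@le_trans _ _ (e1 * (e1 / (K + 1)))); last by rewrite ler_wpM2l // ltW.
rewrite ler_pdivrMr ?exprn_gt0 // ler_pdivrMr //; apply: (le_trans e_small).
by rewrite le_eqVlt; apply/orP; left; apply/eqP; ring.
Qed.

End PhiLower.

Lemma card_finset_pred (n : nat) (T : finType) (th : 'I_n -> T) (a : T) :
  #|boot.finset.finset (fun v => th v == a)| = #|[pred v | th v == a]|.
Proof. by rewrite cardsE. Qed.

(** * Type vectors in which some type is in excess *)

Section TypeCounts.
Variables (R : realType) (T : finType) (n : nat) (la : T -> R) (eta : R).
Hypothesis la0 : forall a, 0 <= la a.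
Hypothesis la1 : \sum_a la a = 1.
Hypothesis eta01 : 0 < eta <= 1.

Definition balanced (th : {ffun 'I_n -> T}) :=
  [forall a, #|[pred v | th v == a]|%:R <= (la a + eta) * n%:R].

Lemma unbalanced_le :
  \sum_(th | ~~ balanced th) \prod_i la (th i) <=
  #|T|%:R * expR (- (eta ^+ 2 / 4 * n%:R)).
Proof.
have w0 (th : {ffun 'I_n -> T}) : 0 <= \prod_i la (th i) by apply: prodr_ge0.
apply: (@le_trans _ _ (\sum_(a : T) \sum_(th : {ffun 'I_n -> T} |
    (la a + eta) * n%:R < (#|[pred v | th v == a]|)%:R) \prod_i la (th i))).
  rewrite (exchange_big_dep predT) //= big_mkcond /=; apply: ler_sum => th _.
  case: ifP => [|_]; last by apply: sumr_ge0.
  rewrite negb_forall => /existsP[a]; rewrite -ltNge => ha.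
  by rewrite (bigD1 a) //= lerDl; apply: sumr_ge0.
rewrite mulr_natl -sumr_const; apply: ler_sum => a _.
exact: (chernoff n la0 la1 a eta01).
Qed.

End TypeCounts.

(** For n = 1 the denominator is 0, and by convention so is the quotient; n = 0 is separate since
    [ln_ge0] wants an argument at least 1. *)
Lemma scale_ge0 (R : realType) (n : nat) : 0 <= n%:R / (2 * ln n%:R) :> R.
Proof.
case: n => [|n]; first by rewrite mul0r.
by rewrite divr_ge0 // mulr_ge0 // ln_ge0 // ler1n.
Qed.

(** * Combination of the step kernel, the colouring and the transfer to the random graph *)

Unset Implicit Arguments.

Theorem theorem2p2 (R : realType) (W : R -> R -> R)
    (W_graphon : is_graphon W)
    (W_riemann : riemann_integrable W)
    (W_sup : sup [set W x y | x in `[0, 1] & y in `[0, 1]] < 1)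
    (d : nat -> measure_display)
    (Omega : forall n : nat, measurableType (d n))
    (P : forall n : nat, probability (Omega n) R)
    (G : forall n : nat, Omega n -> sgraph 'I_n)
    (G_sampled : forall n : nat, is_Gnw W (P n) (G n))
    (M : set (probability R R)) (alpha : probability R R -> R)
    (M_alpha : in_C_lambda M alpha)
    (eps : R) (eps_gt0 : 0 < eps) :
  P n [set w | (((chi (G n w))%:R)%:E <=
                  (\sum_(mu \in M) (alpha mu)%:E * phi mu W + eps%:E)
                  * (n%:R / (2 * ln n%:R))%:E)%E]
    @[n --> \oo] --> 1%E.
Proof.
set sig := sup _ in W_sup.
have sig0 : 0 <= sig by exact: sig_ge0.
have s1 : 0 < 1 - sig by rewrite subr_gt0.
have [M_fin M_supp al_rng al_sum al_mean] := M_alpha.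
pose s := finmap.enum_fset (fset_set M).
pose mui (i : 'I_(size s)) : probability R R := tnth (in_tuple s) i.
have mui_M i : M (mui i).
  have : mui i \in s by exact: mem_tnth.
  by rewrite /s in_fset_set // => /set_mem.
pose al i := alpha (mui i).
have al0 i : 0 <= al i by case/andP: (al_rng _ (mui_M i)).
have al1 : \sum_i al i = 1.
  by rewrite -al_sum fsbig_finite //= -/s (big_tnth _ _ s).
have mean (A : set R) : measurable A -> \sum_i al i * fine (mui i A) = fine (uniform_prob (@ltr01 R) A).
  move=> mA; rewrite -al_mean // fsbig_finite //= -/s (big_tnth _ _ s).
  rewrite (eq_bigr (fun i => (al i * fine (mui i A))%:E)) ?sumEFin // => i _.
  by rewrite EFinM fineK // fin_num_measure.
pose K := - ln (1 - sig).
have K0 : 0 <= K by rewrite /K oppr_ge0 ln_le0 // gerBl.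
(* Half of [eps] pays for [Phi] against [phi], the other half for the colouring. *)
pose e1 := eps / 2.
have e10 : 0 < e1 by rewrite divr_gt0.
(* One step kernel must serve all of [M], so [e] has to be small against every nonzero [al i ^+ 2];
   a zero weight has inverse 0 and does no harm. *)
pose ialpha := 1 + \sum_i (al i ^+ 2)^-1.
have ialpha_ge i : (al i ^+ 2)^-1 <= ialpha.
  rewrite /ialpha (bigD1 i) //= addrCA lerDl addr_ge0 //.
  by apply: sumr_ge0 => j _; rewrite invr_ge0 sqr_ge0.
have ialpha0 : 0 < ialpha.
  by rewrite ltr_wpDr // sumr_ge0 // => j _; rewrite invr_ge0 sqr_ge0.
have K10 : 0 < K + 1 by rewrite ltr_wpDl.
pose e := e1 ^+ 2 * (1 - sig) / (K + 1) / ialpha.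
have e0 : 0 < e by rewrite /e !mulr_gt0 ?invr_gt0 // exprn_gt0.
have [T [tau [U [L [tau_m LUr Usym LWU close]]]]] := riemann_step W_graphon W_riemann e0.
have L_rng a b : 0 <= L a b <= sig.
  by have [-> h1 h2] := LUr a b; rewrite (le_trans h1 h2).
have LU a b : L a b <= U a b <= sig by have [_ -> ->] := LUr a b.
have W_rng x y : x \in `[0, 1] -> y \in `[0, 1] -> L (tau x) (tau y) <= W x y <= sig.
  move=> hx hy; have /andP[-> _] := LWU x y hx hy.
  by have /andP[_ ->] := W_range W_graphon hx hy.
pose mu i a : R := fine (mui i [set x | tau x = a]).
pose la a : R := fine (uniform_prob (@ltr01 R) [set x | tau x = a]).
have laE a : la a = \sum_i al i * mu i a by rewrite /la -mean.
have mu0 i a : 0 <= mu i a by exact: mass_ge0.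
have la0 a : 0 <= la a by rewrite laE sumr_ge0 // => i _; rewrite mulr_ge0.
have la1 : \sum_a la a = 1.
  rewrite (eq_bigr _ (fun a _ => laE a)) exchange_big /= -al1.
  by apply: eq_bigr => i _; rewrite -mulr_sumr mass_sum1 ?mulr1.
pose k a b : R := - ln (1 - U a b).
have k_bnd a b : 0 <= k a b <= K.
  have := @kU_bnd R sig W_sup T L L_rng U LU a b; exact.
have ksym a b : k a b = k b a by rewrite /k Usym.
pose Ph i := Phi (mui i) tau U.
have Ph0 i : 0 <= Ph i by exact: Phi_ge0.
have vertex i (S : {set T}) : \sum_(a in S) \sum_(b in S) mu i a * mu i b * k a b
   <= Ph i * \sum_(a in S) mu i a by exact: Phi_vertex.
have Ph_le i : ((al i * Ph i)%:E <= (al i)%:E * phi (mui i) W + (al i * e1)%:E)%E.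
  (* A measure of weight 0 has no density bound, but it drops out on both sides. *)
  have [->|ali] := eqVneq (al i) 0; first by rewrite !mul0r mul0e adde0.
  have alp : 0 < al i by rewrite lt_neqAle eq_sym ali al0.
  have mu_la a : al i * mu i a <= la a.
    rewrite laE (bigD1 i) //= lerDl sumr_ge0 // => j _.
    by rewrite mulr_ge0.
  have e_small : e <= e1 ^+ 2 * (1 - sig) * al i ^+ 2 / (K + 1).
    rewrite /e [leRHS](_ : _ = e1 ^+ 2 * (1 - sig) / (K + 1) * al i ^+ 2); last by ring.
    rewrite ler_wpM2l //; first by rewrite !mulr_ge0 ?sqr_ge0 ?invr_ge0 // ltW.
    by rewrite -[leRHS]invrK lef_pV2 ?posrE ?invr_gt0 ?exprn_gt0.
  have h := @Phi_le_phi R W sig W_sup (mui i) (M_supp _ (mui_M i)) T tau L tau_m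
    L_rng W_rng U (al i) e e1 LU alp mu_la close e10 e_small.
  rewrite !EFinM -muleDr //; last first.
    by rewrite ge0_adde_def // inE ?lee_fin ?(ltW e10) //; exact: (@phi_ge0 R W sig W_sup (mui i) (M_supp _ (mui_M i)) T tau L tau_m L_rng W_rng).
  by rewrite lee_wpmul2l ?lee_fin.
pose Q := \sum_i al i * Ph i.
have Q_le : ((Q + e1)%:E <= \sum_(mu \in M) (alpha mu)%:E * phi mu W + eps%:E)%E.
  have -> : eps = e1 + e1 by rewrite /e1; lra.
  rewrite fsbig_finite //= -/s (big_tnth _ _ s) !EFinD addeA leeD2r //.
  have {1}-> : e1 = \sum_i al i * e1 by rewrite -mulr_suml al1 mul1r.
  by rewrite /Q -!sumEFin -big_split /=; apply: lee_sum => i _; exact: Ph_le.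
have [eta eta01 tail] := chi_tail k_bnd ksym e10 al0 al1 Ph0 mu0 vertex.
have eta0 : 0 < eta by case/andP: eta01.
pose bad n (om : {ffun 'I_n * 'I_n -> bool}) : bool :=
  ((Q + e1) * (n%:R / (2 * ln n%:R)) < (chi (graph_of om))%:R)%R.
pose E n := [set w | (((chi (G n w))%:R)%:E <=
                  (\sum_(mu \in M) (alpha mu)%:E * phi mu W + eps%:E)
                  * (n%:R / (2 * ln n%:R))%:E)%E].
(* The event depends on the graph alone, so on the finitely many values of [code]. *)
have E_m n : measurable (E n).
  have -> : E n = [set w | (fun om => (((chi (graph_of om))%:R)%:E <=
                  (\sum_(mu \in M) (alpha mu)%:E * phi mu W + eps%:E)
                  * (n%:R / (2 * ln n%:R))%:E)%E) (code (G n) w)].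
    by apply/seteqP; split => w; rewrite /E /= (chi_code (G n) w).
  pose Ev (om : {ffun 'I_n * 'I_n -> bool}) : Prop :=
    (((chi (graph_of om))%:R)%:E <=
      (\sum_(mu \in M) (alpha mu)%:E * phi mu W + eps%:E) *
      (n%:R / (2 * ln n%:R))%:E)%E.
  exact: (@measurable_finType_pred _ _ _ (code (G n)) Ev (code_m (G_sampled n))).
have bad_m n : measurable [set w | bad n (code (G n) w)].
  apply: (@measurable_finType_pred _ _ _ (code (G n)) (fun om => bad n om)) => om.
  exact: (code_m (G_sampled n)).
have E_ge n : (1 - P n [set w | bad n (code (G n) w)] <= P n (E n))%E.
  rewrite -probability_setC //; apply: le_measure; rewrite ?inE //.
    exact: measurableC.
  move=> w /= /negP; rewrite /bad -leNgt -(chi_code (G n) w) => h.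
  apply: le_trans (lee_wpmul2r _ Q_le); last by rewrite lee_fin scale_ge0.
  by rewrite -EFinM lee_fin.
have W_le x y : x \in `[0, 1] -> y \in `[0, 1] -> W x y <= 1 - expR (- k (tau x) (tau y)).
  move=> hx hy; have /andP[_ h] := LWU x y hx hy.
  rewrite /k opprK lnK ?posrE; first by rewrite opprB addrCA subrr addr0.
  by have /andP[_ h'] := LU (tau x) (tau y); rewrite subr_gt0 (le_lt_trans h').
(* One [del] for unbalanced type vectors, one for the failure of the colouring bound given balanced
   types. *)
have bad_small del : 0 < del ->
  \forall n \near \oo, (P n [set w | bad n (code (G n) w)] <= (del + del)%:E)%E.
  move=> del0; near=> n.
  have tl : forall (th : 'I_n -> T) (p : 'I_n * 'I_n -> R),
    (forall a, #|boot.finset.finset (fun v => th v == a)|%:R <= (\sum_i al i * mu i a + eta) * n%:R) ->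
    is_proba p -> (forall e, p e <= bprob th k e) ->
    Ex p (fun w => ((\sum_i al i * Ph i + e1) * (n%:R / (2 * ln n%:R)) <
      (chi (graph_of w))%:R)%R%:R) <= del by near: n; exact: tail.
  apply: le_trans (transfer (G_sampled n) W_graphon tau_m W_le
     (good := @balanced R T n la eta) (bad := bad n) (ltW del0) _) _.
    move=> th /forallP gth p hp pb; apply: tl => // a.
    by rewrite card_finset_pred -laE; exact: gth.
  rewrite lee_fin lerD2r; apply: le_trans (unbalanced_le n la0 la1 eta01) _.
  have n_big : #|T|%:R / del / (eta ^+ 2 / 4) <= n%:R by near: n; exact: nbhs_infty_ger.
  have q0 : 0 < eta ^+ 2 / 4 by rewrite divr_gt0 // exprn_gt0.
  rewrite expRN ler_pdivrMr ?expR_gt0 //.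
  move: n_big; rewrite ler_pdivrMr // ler_pdivrMr // => h.
  apply: (le_trans h); rewrite mulrC ler_wpM2l ?(ltW del0) // mulrC.
  by apply: le_trans (expR_ge1Dx _); rewrite lerDr.
apply/fine_cvgP; split.
  by near=> n; apply: fin_num_measure; exact: E_m.
apply/cvgrPdist_le => del del0.
have del2 : 0 < del / 2 by rewrite divr_gt0.
have := bad_small _ del2; apply: filterS => n hn /=.
rewrite -/(E n).
have Efin : P n (E n) \is a fin_num by apply: fin_num_measure; exact: E_m.
have E1 : fine (P n (E n)) <= 1 by rewrite -lee_fin fineK // probability_le1.
have : ((1 - del)%:E <= P n (E n))%E.
  apply: le_trans (E_ge n); rewrite EFinB leeB //.
  by apply: le_trans hn _; rewrite lee_fin; lra.
rewrite -[P n (E n)]fineK // lee_fin => E2.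
by rewrite ger0_norm ?subr_ge0 //; lra.
Unshelve. all: by end_near. Qed.
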